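(* Let the data be i.i.d. from a true distribution denoted $P_{\theta_0}$, where $\theta_0\notin\Theta$ (misspecified model), and let $\theta^*:=\arg\min_{\theta\in\Theta}\mathcal{K}(P_{\theta_0},P_\theta)$. Assume $\mathbb{E}\|X_1\|^2<\infty$, and put $K_1:=2\,\mathbb{E}\|X_1\|$. Let $C_1>0$, $\tau=(n\sqrt d)^{-1}$ with $C_1>2d\tau$, and assume $\|\theta^*\|_1\le C_1-2d\tau$. Then for every $\alpha\in(0,1)$, $$\mathbb{E}\left[\int D_\alpha(P_\theta,P_{\theta_0})\,\pi_{n,\alpha}(\mathrm{d}\theta)\right]\le \frac{\alpha}{1-\alpha}\min_{\theta\in\Theta}\mathcal{K}(P_{\theta_0},P_\theta)+\frac{1+\alpha}{1-\alpha}\,r_n,$$ where $$r_n=\frac{K_1}{n}\vee\frac{4\|\theta^*\|_0\log\left(\frac{C_1 n\sqrt d}{\|\theta^*\|_0}\right)+\log 2}{n}.$$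
   Context: Data: $Z_i=(Y_i,X_i)\in\{-1,1\}\times\mathbb{R}^d$, $i=1,\dots,n$, are i.i.d. with true law $P_{\theta_0}$, and $\mathbb{E}$ is expectation under the true law. Model: $\{P_\theta:\theta\in\Theta\}$, where $\Theta\subseteq\mathbb{R}^d$ is the parameter set (containing the support $B_1(C_1)$ of the prior below) and $P_\theta$ is the joint law of $(Y,X)$ for which $X$ has the same marginal law as under $P_{\theta_0}$ (the law of the design does not depend on the parameter) and $p_\theta(y|x)=\mathbb{P}(Y=y\mid X=x,\theta)=\frac{e^{yx^\top\theta}}{1+e^{yx^\top\theta}}$. $\|\cdot\|=\|\cdot\|_2$ is the Euclidean norm, $\|\cdot\|_1$ the $\ell_1$ norm, $\|\theta\|_0$ the number of nonzero entries of $\theta$, $a\vee b=\max(a,b)$, and $0\log(c/0)$ is read as $0$. Prior: for $C_1>0$, $\tau>0$, $\pi$ is the probability distribution supported on $B_1(C_1)=\{\theta\in\mathbb{R}^d:\|\theta\|_1\le C_1\}$ with density $\pi(\theta)\propto\prod_{i=1}^d(\tau^2+\theta_i^2)^{-2}$ on $B_1(C_1)$. Fractional posterior: $\pi_{n,\alpha}(\mathrm{d}\theta)\propto L_n(\theta)^\alpha\,\pi(\mathrm{d}\theta)$, where $L_n(\theta)=\prod_{i=1}^n p_\theta(Y_i|X_i)$; it depends on the data $Z_1,\dots,Z_n$. Divergences: for $\alpha\in(0,1)$ and probability measures $P,R$ dominated by $\mu$, $D_\alpha(P,R)=\frac{1}{\alpha-1}\log\int\left(\frac{\mathrm{d}P}{\mathrm{d}\mu}\right)^\alpha\left(\frac{\mathrm{d}R}{\mathrm{d}\mu}\right)^{1-\alpha}\mathrm{d}\mu$;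 $\mathcal{K}(P,R)=\int\log\left(\frac{\mathrm{d}P}{\mathrm{d}R}\right)\mathrm{d}P$ if $P\ll R$ and $+\infty$ otherwise (Kullback-Leibler divergence). *)

(* Defs.v *)
From HB Require Import structures.
From mathcomp Require Import all_boot all_order all_algebra.
From mathcomp Require Import all_classical all_reals all_analysis.
From mathcomp Require Import measurable_realfun ring.

Set Implicit Arguments.
Unset Strict Implicit.
Unset Printing Implicit Defensive.
Import Order.TTheory GRing.Theory Num.Theory.
Import numFieldNormedType.Exports.
Local Open Scope classical_set_scope.
Local Open Scope ring_scope.

Section mdensity.
Context disp (T : measurableType disp) (R : realType).
Context (mu : {measure set T -> \bar R}) (f : T -> R).

Definition mdensity of measurable_fun [set: T] f & (forall x, 0 <= f x) :=
  fun A : set T => (\int[mu]_(x in A) (f x)%:E)%E.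

Context (mf : measurable_fun [set: T] f) (f0 : forall x, 0 <= f x).

Let mdensity0 : mdensity mf f0 set0 = 0%E.
Proof. by rewrite /mdensity integral_set0. Qed.

Let mdensity_ge0 A : (0 <= mdensity mf f0 A)%E.
Proof. by apply: integral_ge0 => x _; rewrite lee_fin. Qed.

Let mdensity_sigma_additive : semi_sigma_additive (mdensity mf f0).
Proof.
apply: semi_sigma_additive_nng_induced; first exact/measurable_EFinP.
by move=> x; rewrite lee_fin.
Qed.

HB.instance Definition _ := isMeasure.Build _ _ _ (mdensity mf f0)
  mdensity0 mdensity_ge0 mdensity_sigma_additive.

End mdensity.

(* R^n. The carrier is written measurableTypeR R, which is R itself equipped
   with the Borel sigma-algebra on which lebesgue_measure is defined; the
   sigma-algebra on tuples is the product one. *)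
Definition vec (R : realType) (n : nat) : Type := n.-tuple (measurableTypeR R).
HB.instance Definition _ (R : realType) (n : nat) :=
  Measurable.copy (vec R n) (n.-tuple (measurableTypeR R)).

Definition coord (R : realType) (n : nat) (x : vec R n) (i : 'I_n) : R := tnth x i.

(* Lebesgue measure on R^n, as the n-fold product of the Lebesgue measure on R. *)
Section lebesgue_vec.
Context (R : realType).

Section step.
Context (n : nat) (m : {sigma_finite_measure set (vec R n) -> \bar R}).

Definition vec_cons (p : measurableTypeR R * vec R n) : vec R n.+1 :=
  [tuple of p.1 :: p.2].

Definition vec_uncons (t : vec R n.+1) : measurableTypeR R * vec R n :=
  (thead t, [tuple of behead t]).

Lemma vec_unconsK : cancel vec_uncons vec_cons.
Proof. by move=> t; rewrite /vec_cons /vec_uncons/= -tuple_eta. Qed.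

Lemma vec_consK : cancel vec_cons vec_uncons.
Proof.
by case=> x t; rewrite /vec_uncons /vec_cons/= theadE; congr pair; exact: val_inj.
Qed.

Lemma measurable_vec_cons : measurable_fun setT vec_cons.
Proof. exact: measurable_cons. Qed.

Lemma measurable_vec_uncons : measurable_fun setT vec_uncons.
Proof.
apply: measurable_fun_pair; last exact: measurable_behead.
exact: measurable_tnth.
Qed.

Definition lebesgue_vecS (A : set (vec R n.+1)) : \bar R :=
  (lebesgue_measure \x m)%E (vec_cons @^-1` A).

Let lebesgue_vecS0 : lebesgue_vecS set0 = 0%E.
Proof. by rewrite /lebesgue_vecS preimage_set0 measure0. Qed.

Let lebesgue_vecS_ge0 A : (0 <= lebesgue_vecS A)%E.
Proof. exact: measure_ge0. Qed.

Let lebesgue_vecS_sigma_additive : semi_sigma_additive lebesgue_vecS.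
Proof.
exact: (@measure_semi_sigma_additive _ _ _
  (measure_function_pushforward__canonical__measure_function_Measure
     (lebesgue_measure \x m)%E measurable_vec_cons)).
Qed.

HB.instance Definition _ := isMeasure.Build _ _ _ lebesgue_vecS
  lebesgue_vecS0 lebesgue_vecS_ge0 lebesgue_vecS_sigma_additive.

Let lebesgue_vecS_sigma_finite : sigma_finite setT lebesgue_vecS.
Proof.
have /sigma_finiteP[F [TF ndF Foo]] := sigma_finiteT (@lebesgue_measure R).
have /sigma_finiteP[G [TG ndG Goo]] := sigma_finiteT m.
exists (fun i => vec_uncons @^-1` (F i `*` G i)).
  rewrite -preimage_bigcup.
  suff -> : \bigcup_i (F i `*` G i) = [set: _] by rewrite preimage_setT.
  rewrite -setXTT TF TG predeqE => -[x y]; split.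
    by move=> [k _ []/= ? ?]; split; exists k.
  move=> [/= [i _ Fix] [j _ Gjy]]; exists (maxn i j) => //; split.
  - by move: x Fix; exact/subsetPset/ndF/leq_maxl.
  - by move: y Gjy; exact/subsetPset/ndG/leq_maxr.
move=> i; have [mF Fioo] := Foo i; have [mG Gioo] := Goo i.
have mFG : measurable (F i `*` G i) by exact: measurableX.
split; first by rewrite -[X in measurable X]setTI; exact: measurable_vec_uncons.
rewrite /lebesgue_vecS -comp_preimage (_ : _ \o _ = id); last first.
  by apply/funext => x; exact: vec_consK.
by rewrite preimage_id product_measure1E// lte_mul_pinfty// ge0_fin_numE.
Qed.

HB.instance Definition _ := Measure_isSigmaFinite.Build _ _ _ lebesgue_vecS
  lebesgue_vecS_sigma_finite.

End step.

Fixpoint lebesgue_vec (n : nat) : {sigma_finite_measure set (vec R n) -> \bar R} :=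
  match n with
  | 0 => dirac ([tuple] : vec R 0)
  | n'.+1 => lebesgue_vecS (lebesgue_vec n')
  end.

End lebesgue_vec.

Section divergences.
Context disp (T : measurableType disp) (R : realType).
Implicit Types P Q : probability T R.

Definition prob_add P Q : set T -> \bar R := measure_add P Q.

Section instance.
Context (P Q : probability T R).

HB.instance Definition _ := Measure.on (prob_add P Q).

Let prob_add_fin : fin_num_fun (prob_add P Q).
Proof.
move=> A mA; rewrite /prob_add measure_addE fin_numD.
by rewrite !fin_num_measure.
Qed.

HB.instance Definition _ := Measure_isFinite.Build _ _ _ (prob_add P Q)
  prob_add_fin.
End instance.

Local Open Scope ereal_scope.
Local Open Scope charge_scope.

(* D_alpha does not depend on the choice of the dominating measure;
   P + Q always dominates both P and Q. The value is +oo when the integral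
   vanishes (lne 0 = -oo). *)
Definition renyi_div (alpha : R) P Q : \bar R :=
  let mu := prob_add P Q in
  let dP := 'd (charge_of_finite_measure P) '/d mu in
  let dQ := 'd (charge_of_finite_measure Q) '/d mu in
  ((alpha - 1)^-1)%:E *
    lne (\int[mu]_z (poweR (dP z) alpha * poweR (dQ z) (1 - alpha))).

Definition kl_div P Q : \bar R :=
  if `[< P `<< Q >] then
    \int[P]_z lne (('d (charge_of_finite_measure P) '/d Q) z)
  else +oo.

End divergences.

Section logistic.
Context (R : realType) (d : nat).
Implicit Types (x theta : vec R d) (y : bool).

Definition dotv x theta : R := \sum_i coord x i * coord theta i.

Definition norm1 theta : R := \sum_i `|coord theta i|.

Definition norm2 theta : R := Num.sqrt (\sum_i coord theta i ^+ 2).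

Definition norm0 theta : nat := #|[set i | coord theta i != 0]|.

Definition l1_ball (c : R) : set (vec R d) := [set theta | norm1 theta <= c].

(* The label space {-1, 1} is encoded as bool, true standing for 1. *)
Definition label y : R := if y then 1 else -1.

Definition logit_pmf theta y x : R :=
  expR (label y * dotv x theta) / (1 + expR (label y * dotv x theta)).

Lemma logit_pmf_ge0 theta y x : 0 <= logit_pmf theta y x.
Proof. by rewrite divr_ge0 ?addr_ge0 ?expR_ge0. Qed.

Lemma logit_pmfD theta x : logit_pmf theta true x + logit_pmf theta false x = 1.
Proof.
rewrite /logit_pmf /label mulN1r mul1r expRN.
have e0 := expR_gt0 (dotv x theta).
field.
by rewrite gt_eqF// gt_eqF// addr_gt0.
Qed.

Lemma measurable_coord i : measurable_fun setT (fun x => coord x i).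
Proof. exact: (@measurable_tnth _ (measurableTypeR R)). Qed.

Lemma measurable_dotvl theta : measurable_fun setT (dotv ^~ theta).
Proof.
by apply: measurable_sum => i; apply: measurable_funM => //; exact: measurable_coord.
Qed.

Lemma measurable_dotvr x : measurable_fun setT (dotv x).
Proof.
by apply: measurable_sum => i; apply: measurable_funM => //; exact: measurable_coord.
Qed.

Let F y (t : R) : R := expR (label y * t) / (1 + expR (label y * t)).

Let measurable_F y : measurable_fun setT (F y).
Proof.
apply: continuous_measurable_fun => t.
have ce : (fun u : R => expR (label y * u)) @ t --> expR (label y * t).
  apply: (@continuous_comp _ _ _ (fun u => label y * u) expR).
    exact: mulrl_continuous.
  exact: continuous_expR.
apply: cvgM => //; apply: cvgV; first by rewrite gt_eqF// addr_gt0// expR_gt0.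
by apply: cvgD => //; exact: cvg_cst.
Qed.

Lemma measurable_logit_pmf theta y : measurable_fun setT (logit_pmf theta y).
Proof. exact: (measurableT_comp (measurable_F y) (measurable_dotvl theta)). Qed.

Lemma measurable_logit_pmf_param y x :
  measurable_fun setT (fun theta => logit_pmf theta y x).
Proof. exact: (measurableT_comp (measurable_F y) (measurable_dotvr x)). Qed.

(* Joint law of (Y, X) when X ~ m and P(Y = y | X = x) = logit_pmf theta y x. *)
Section model.
Context (m : probability (vec R d) R) (theta : vec R d).

Definition logit_model (A : set (bool * vec R d)) : \bar R :=
  (\sum_(y : bool) \int[m]_(x in [set x | A (y, x)]) (logit_pmf theta y x)%:E)%E.

Let part y : {measure set (vec R d) -> \bar R} :=
  mdensity m (measurable_logit_pmf theta y) (logit_pmf_ge0 theta y).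

Let section_bigcup y (G : (set (bool * vec R d))^nat) :
  [set x | (\bigcup_i G i) (y, x)] = \bigcup_i [set x | G i (y, x)].
Proof. by apply/seteqP; split => x [k _ kx]; exists k. Qed.

Let logit_model0 : logit_model set0 = 0%E.
Proof. by rewrite /logit_model big1// => y _; exact: (measure0 (part y)). Qed.

Let logit_model_ge0 A : (0 <= logit_model A)%E.
Proof. by apply: sume_ge0 => y _; exact: (measure_ge0 (part y)). Qed.

Let logit_model_sigma_additive : semi_sigma_additive logit_model.
Proof.
have mpair y : measurable_fun setT (pair y : vec R d -> bool * vec R d).
  exact: measurable_pair1.
pose q y := measure_function_pushforward__canonical__measure_function_Measure
  (part y) (mpair y).
have -> : logit_model = measure_add (q true) (q false).
  by apply/funext => A; rewrite measure_addE /logit_model big_bool.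
exact: measure_semi_sigma_additive.
Qed.

HB.instance Definition _ := isMeasure.Build _ _ _ logit_model
  logit_model0 logit_model_ge0 logit_model_sigma_additive.

Let logit_modelT : logit_model setT = 1%E.
Proof.
rewrite /logit_model big_bool/=.
have -> : [set x : vec R d | True] = setT by [].
have mp y : measurable_fun setT (EFin \o (logit_pmf theta y)).
  by apply/measurable_EFinP; exact: measurable_logit_pmf.
rewrite -ge0_integralD//=;
  [|by move=> x _; rewrite lee_fin logit_pmf_ge0|exact: mp
   |by move=> x _; rewrite lee_fin logit_pmf_ge0|exact: mp].
under eq_integral do rewrite -EFinD logit_pmfD.
by rewrite integral_cst// mul1e; exact: probability_setT.
Qed.

HB.instance Definition _ := Measure_isProbability.Build _ _ _ logit_model
  logit_modelT.

End model.

Section x_marginal.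
Context (P : probability (bool * vec R d)%type R).

Let msnd : measurable_fun setT (snd : bool * vec R d -> vec R d).
Proof. exact: measurable_snd. Qed.

Definition x_marginal : set (vec R d) -> \bar R := pushforward P snd.

Let x_marginal0 : x_marginal set0 = 0%E. Proof. exact: measure0. Qed.

Let x_marginal_ge0 A : (0 <= x_marginal A)%E. Proof. exact: measure_ge0. Qed.

Let x_marginal_sigma_additive : semi_sigma_additive x_marginal.
Proof.
exact: (@measure_semi_sigma_additive _ _ _
  (measure_function_pushforward__canonical__measure_function_Measure P msnd)).
Qed.

HB.instance Definition _ := isMeasure.Build _ _ _ x_marginal
  x_marginal0 x_marginal_ge0 x_marginal_sigma_additive.

Let x_marginalT : x_marginal setT = 1%E.
Proof. exact: (probability_setT P). Qed.

HB.instance Definition _ := Measure_isProbability.Build _ _ _ x_marginal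
  x_marginalT.

End x_marginal.

Definition likelihood (n : nat) (z : 'I_n -> bool * vec R d) theta : R :=
  \prod_(i < n) logit_pmf theta (z i).1 (z i).2.

Definition prior_weight (c tau : R) theta : R :=
  \1_(l1_ball c) theta * \prod_(i < d) ((tau ^+ 2 + coord theta i ^+ 2) ^- 2).

Lemma measurable_l1_ball c : measurable (l1_ball c).
Proof.
have mn : measurable_fun setT norm1.
  apply: measurable_sum => i.
  exact: (measurableT_comp (@normr_measurable R setT) (measurable_coord i)).
rewrite (_ : l1_ball c = norm1 @^-1` `]-oo, c]).
  by rewrite -[X in measurable X]setTI; exact: mn.
by apply/seteqP; split => x; rewrite /l1_ball/= in_itv.
Qed.

Lemma prior_weight_ge0 c tau theta : 0 <= prior_weight c tau theta.
Proof.
rewrite mulr_ge0 ?indicE//; apply: prodr_ge0 => i _.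
by rewrite invr_ge0 exprn_ge0// addr_ge0// sqr_ge0.
Qed.

Lemma measurable_prior_weight c tau : measurable_fun setT (prior_weight c tau).
Proof.
apply: measurable_funM; first by apply: measurable_indic; exact: measurable_l1_ball.
apply: measurable_prod => i _.
pose g theta := (tau ^+ 2 + coord theta i ^+ 2) ^+ 2.
have mg : measurable_fun setT g.
  apply: measurable_funX; apply: measurable_funD => //.
  by apply: measurable_funX; exact: measurable_coord.
rewrite (_ : (fun _ => _) = (@powR R ^~ (-1)) \o g).
  exact: (measurableT_comp (measurable_powR (-1))).
by apply/funext => theta /=; rewrite powR_inv1// sqr_ge0.
Qed.

Lemma likelihood_powR_ge0 (n : nat) (z : 'I_n -> bool * vec R d) (alpha : R) theta :
  0 <= likelihood z theta `^ alpha.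
Proof. exact: powR_ge0. Qed.

Lemma measurable_likelihood_powR (n : nat) (z : 'I_n -> bool * vec R d) (alpha : R) :
  measurable_fun setT (fun theta => likelihood z theta `^ alpha).
Proof.
apply: (measurableT_comp (measurable_powR alpha)).
by apply: measurable_prod => i _; exact: measurable_logit_pmf_param.
Qed.

(* mnormalize divides by the total mass; its last argument is the default value
   for a mass equal to 0 or +oo, which occurs neither for the prior when
   c, tau > 0, nor for the posterior since the likelihood lies in ]0, 1]. *)
Definition prior (c tau : R) : probability (vec R d) R :=
  mnormalize
    (mdensity (lebesgue_vec R d) (measurable_prior_weight c tau)
      (prior_weight_ge0 c tau))
    (dirac ([tuple of nseq d 0] : vec R d)).

Definition frac_posterior (pi : probability (vec R d) R) (alpha : R) (n : nat)
    (z : 'I_n -> bool * vec R d) : probability (vec R d) R :=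
  mnormalize
    (mdensity pi (measurable_likelihood_powR z alpha) (likelihood_powR_ge0 z alpha))
    pi.

End logistic.

Definition has_law disp (Omega : measurableType disp) disp' (T : measurableType disp')
    (R : realType) (P : probability Omega R) (X : {mfun Omega >-> T})
    (Q : probability T R) : Prop :=
  forall A, measurable A -> P (X @^-1` A) = Q A.

Definition mutually_independent disp (Omega : measurableType disp)
    disp' (T : measurableType disp') (R : realType) (P : probability Omega R)
    (n : nat) (Z : 'I_n -> {mfun Omega >-> T}) : Prop :=
  forall (J : {set 'I_n}) (A : 'I_n -> set T), (forall i, measurable (A i)) ->
    P (\bigcap_(i in [set` J]) (Z i @^-1` A i)) =
    (\prod_(i in J) P (Z i @^-1` A i))%E.

Arguments l1_ball {R d} c.

(* Main.v *)
(* Write M for the model at theta_star, q for the density of the true law P0 with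
   respect to M, p_theta for the ratio of the models at theta and theta_star, and
   a(theta) for the affinity, the integral of p_theta^alpha q^(1 - alpha) against
   M, so that n (1 - alpha) D_alpha = ln (a(theta)^-n). If P0 is not dominated by M
   or has infinite divergence from it, the right-hand side is infinite. Otherwise,
   by independence, a(theta)^-n prod_i (p_theta / q)(Z_i)^alpha has expectation 1
   for every theta, hence also after integration against the prior. Applying the
   tangent-line form of Jensen's inequality for ln under the posterior bounds the
   posterior integral of n (1 - alpha) D_alpha by this quantity, minus 1, plus
   alpha sum_i ln q(Z_i), minus the log-evidence. The evidence is bounded below
   pointwise in the data by comparing the prior with its translate to theta_star,
   restricted to the l1 ball of radius 2 d tau: the log-likelihood is Lipschitz in
   theta with constant the norm of the design, and the translated weight has second
   moment at most d tau^2 = 1 / n^2 after truncation of each coordinate. *)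
From HB Require Import structures.
From mathcomp Require Import all_boot all_order all_algebra.
From mathcomp Require Import all_classical all_reals all_analysis.
From mathcomp Require Import measurable_realfun ring lra.
Require Import Defs.

Set Implicit Arguments.
Unset Strict Implicit.
Unset Printing Implicit Defensive.
Import Order.TTheory GRing.Theory Num.Theory.
Import numFieldNormedType.Exports.
Local Open Scope classical_set_scope.
Local Open Scope ring_scope.

(** * Densities, normalisation and independence *)

(** Dominating everything by the model at [theta_star] gives each model law an explicit positive
    density, jointly measurable in parameter and observation as Tonelli requires, and lets one [q]
    serve all parameters; [q] times the conditional density at [theta_star] then plays the part of
    the true likelihood. The tangent line replaces Jensen's inequality because its contact point may
    depend on the data and because it remains true where the integral on the right is infinite.
    Since the evidence is bounded below pointwise, only the norms of the design and [ln q] have to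
    be integrable; the log-evidence itself is never integrated. Origin of the constants: with [tau]
    as chosen, the translated weight has root mean square distance at most 1/n from [theta_star], so
    all n observations together change the log-likelihood by an amount of order [E ||X||], doubled
    in [K1]. The logarithmic term is the price of translating a weight with polynomial tails, paid
    only on the nonzero coordinates of [theta_star], and [ln 2] pays for the restriction to the
    small l1 ball. *)

Section density.
Local Open Scope ereal_scope.
Context d (T : measurableType d) (R : realType).
Import HBNNSimple.

(** Standard machine: approximate [g] by simple functions and pass to the limit by monotone
    convergence on both sides. Both measures are arbitrary, so the lemma serves densities against
    Lebesgue measure as well as against probability laws. *)
Lemma ge0_integral_density (mu nu : {measure set T -> \bar R}) (f : T -> R)
    (g : T -> \bar R) :
  measurable_fun setT f -> (forall x, 0 <= f x)%R ->
  (forall A, measurable A -> nu A = \int[mu]_(x in A) (f x)%:E) ->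
  measurable_fun setT g -> (forall x, 0 <= g x) ->
  \int[nu]_x g x = \int[mu]_x (g x * (f x)%:E).
Proof.
move=> mf f0 nuE mg g0.
have mEf : measurable_fun setT (EFin \o f) by exact/measurable_EFinP.
pose h := nnsfun_approx measurableT mg.
have hg x : (h n x)%:E @[n --> \oo] --> g x by exact: cvg_nnsfun_approx.
have mh n : measurable_fun setT (EFin \o h n) by exact/measurable_EFinP.
have ndh x a b : (a <= b)%N -> (h a x)%:E <= (h b x)%:E.
  by move=> ab; rewrite lee_fin; exact/lefP/nd_nnsfun_approx.
have -> : \int[nu]_x g x = limn (fun n => \int[nu]_x (h n x)%:E).
  rewrite -monotone_convergence//.
  - by apply: eq_integral => x _; apply/esym/cvg_lim => //; exact: hg.
  - by move=> n x _; rewrite lee_fin.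
  - by move=> x _ a b; exact: ndh.
have -> : \int[mu]_x (g x * (f x)%:E) =
          limn (fun n => \int[mu]_x ((h n x)%:E * (f x)%:E)).
  rewrite -monotone_convergence//.
  - by apply: eq_integral => x _; apply/esym/cvg_lim => //; apply: cvgeZr => //.
  - by move=> n; exact: (emeasurable_funM (mh n) mEf).
  - by move=> n x _; rewrite mule_ge0// lee_fin.
  - by move=> x _ a b ab; rewrite lee_wpmul2r ?lee_fin//; apply: ndh.
congr (limn _); apply/funext => n.
have mB r : measurable (h n @^-1` [set r]) by [].
have mi r : measurable_fun setT (fun x => (r * \1_(h n @^-1` [set r]) x)%:E : \bar R).
  by apply/measurable_EFinP; exact: measurable_funM.
transitivity (\int[nu]_x (\sum_(y \in range (h n)) (y * \1_(h n @^-1` [set y]) x)%:E)).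
  by apply: eq_integral => t _; rewrite /= fimfunE -fsumEFin.
rewrite ge0_integral_fsum//; last by move=> m y _; exact: nnfun_muleindic_ge0.
transitivity (\int[mu]_x (\sum_(y \in range (h n))
    (y * \1_(h n @^-1` [set y]) x)%:E * (f x)%:E)); last first.
  apply: eq_integral => x _.
  rewrite -ge0_mule_fsuml => [|y]; last exact: nnfun_muleindic_ge0.
  by rewrite fsumEFin // -(fimfunE _ x).
rewrite ge0_integral_fsum//; last 2 first.
  - by move=> y; exact: (emeasurable_funM (mi y) mEf).
  - move=> m y _; apply: mule_ge0; last by rewrite lee_fin.
    exact: nnfun_muleindic_ge0.
apply: eq_fsbigr => r /set_mem [x _ <-].
under eq_integral do rewrite EFinM.
under [RHS]eq_integral do rewrite EFinM -muleA.
rewrite !ge0_integralZl// ?lee_fin//; last 3 first.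
  - by apply: emeasurable_funM => //; exact/measurable_EFinP.
  - by move=> t _; rewrite mule_ge0 ?lee_fin.
  - exact/measurable_EFinP.
congr (_ * _); rewrite integral_indic// setIT nuE//.
rewrite integral_mkcond; apply: eq_integral => t _.
by rewrite epatch_indic muleC.
Qed.

End density.

Section normalized.
Local Open Scope ereal_scope.
Context d (T : measurableType d) (R : realType).

(** The two hypotheses on the mass exclude the default branch of [mnormalize], where the integral
    would be against [P]. *)
Lemma ge0_integral_mnormalize (mu : {measure set T -> \bar R})
    (P : probability T R) (g : T -> \bar R) :
  mu setT != 0 -> mu setT != +oo ->
  measurable_fun setT g -> (forall x, 0 <= g x) ->
  \int[mnormalize mu P]_x g x = (fine (mu setT))^-1%:E * \int[mu]_x g x.
Proof.
move=> mu0 muoo mg g0.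
have c0 : (0 <= (fine (mu setT))^-1)%R by rewrite invr_ge0 fine_ge0.
rewrite -(ge0_integral_mscale mu measurableT (NngNum c0) mg)//.
apply: eq_measure_integral => A mA _.
rewrite /= /mnormalize; case: ifPn => [/orP[]|_]; last by rewrite /mscale/= muleC.
  by rewrite (negbTE mu0).
by rewrite (negbTE muoo).
Qed.

End normalized.

Section independence.
Local Open Scope ereal_scope.
Context disp (Omega : measurableType disp) disp' (T : measurableType disp')
  (R : realType) (P : probability Omega R) (n : nat)
  (Z : 'I_n -> {mfun Omega >-> T}).
Hypothesis Z_indep : mutually_independent P Z.

(* The indicators of arbitrary events are replaced by the functions one index
   at a time. *)
Lemma ge0_expectation_prod (f : 'I_n -> T -> R) :
  (forall i, measurable_fun setT (f i)) -> (forall i x, 0 <= f i x)%R ->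
  (forall i, \int[P]_w (f i (Z i w))%:E < +oo) ->
  \int[P]_w (\prod_i f i (Z i w))%:E = \prod_i \int[P]_w (f i (Z i w))%:E.
Proof.
move=> mf f0 foo.
pose g (k : nat) (A : 'I_n -> set T) (i : 'I_n) (x : T) : R :=
  if (i < k)%N then f i x else \1_(A i) x.
suff H k : (k <= n)%N -> forall A, (forall i, measurable (A i)) ->
    \int[P]_w (\prod_i g k A i (Z i w))%:E = \prod_i \int[P]_w (g k A i (Z i w))%:E.
  (* At [k = n] every factor is some [f i] and the events have disappeared, so any family of events
     can be supplied. *)
  have := H n (leqnn n) (fun=> set0) (fun=> measurable0).
  rewrite /g; under eq_integral do under eq_bigr do rewrite ltn_ord.
  by under [RHS]eq_bigr do under eq_integral do rewrite ltn_ord.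
have mZ i : measurable_fun setT (Z i) by [].
elim: k => [_ A mA|k IH kn A mA].
  rewrite /g/=.
  have -> : \prod_i \int[P]_w (\1_(A i) (Z i w))%:E =
      \prod_(i in [set: 'I_n]%SET) P (Z i @^-1` A i).
    rewrite [RHS](eq_bigl xpredT); last by move=> i; rewrite inE.
    apply: eq_bigr => i _.
    have mZA : measurable (Z i @^-1` A i) by rewrite -[X in measurable X]setTI; exact: mZ.
    by rewrite -[in RHS](setIT (_ @^-1` _)) -integral_indic.
  rewrite -Z_indep//.
  have mB : measurable (\bigcap_(i in [set` [set: 'I_n]%SET]) (Z i @^-1` A i)).
    apply: fin_bigcap_measurable => // i _.
    by rewrite -[X in measurable X]setTI; exact: mZ.
  rewrite -(setIT (\bigcap_(i in _) _)) -integral_indic//; apply: eq_integral => w _; congr EFin.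
  rewrite [RHS]indicE; case: (boolP (w \in _)) => [/set_mem wB|].
    rewrite big1// => i _; rewrite indicE mem_set//.
    by apply: (wB i); rewrite /= inE.
  rewrite notin_setE => wB.
  have [i wi] : exists i, ~ A i (Z i w).
    by apply/existsNP => h; apply: wB => i _; exact: h.
  by rewrite (bigD1 i)//= indicE memNset ?mul0r.
pose j := Ordinal kn.
have g0 m B i x : (0 <= g m B i x)%R by rewrite /g; case: ifP => _; rewrite ?indicE.
pose X w := (\prod_(i | i != j) g k.+1 A i (Z i w))%R.
have X0 w : (0 <= X w)%R by apply: prodr_ge0 => i _; exact: g0.
have gS i : measurable_fun setT (g k.+1 A i).
  by rewrite /g; case: (i < k.+1)%N; [exact: mf|exact: measurable_indic].
have mX : measurable_fun setT X.
  rewrite /X; under eq_fun do rewrite big_mkcond.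
  apply: measurable_prod => i _; case: (i != j) => //=.
  exact: (measurableT_comp (gS i) (mZ i)).
pose c := (\prod_(i | i != j) \int[P]_w (g k.+1 A i (Z i w))%:E).
have c0 : 0 <= c.
  by apply: prode_ge0 => i _; apply: integral_ge0 => w _; rewrite lee_fin g0.
(* Finiteness matters because [fine c] is used below as a real constant density. *)
have cfin : c \is a fin_num.
  rewrite /c; apply: (big_ind (fun x : \bar R => x \is a fin_num)) => //;
    [by move=> x y; exact: fin_numM|move=> i _].
  rewrite ge0_fin_numE; last by apply: integral_ge0 => w _; rewrite lee_fin g0.
  rewrite /g; case: (i < k.+1)%N; first exact: foo.
  apply: (@le_lt_trans _ _ (\int[P]_w 1%:E)); last first.
    rewrite integral_cst// mul1e.
    exact: (le_lt_trans (probability_le1 P measurableT) (ltry 1)).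
  apply: ge0_le_integral => //.
  - apply/measurable_EFinP.
    exact: (measurableT_comp (measurable_indic (mA i)) (mZ i)).
  - by move=> w _; rewrite lee_fin indicE; case: (_ \in _).
pose A' B i := if i == j then B else A i.
(* The induction hypothesis with [B] as event at index [j] says that the image under [Z j] of the
   measure with density [X] is [c] times the law of [Z j]. Integrating [f j] against both measures
   moves index [j] from indicators to functions. *)
have XB B : measurable B ->
    \int[P]_w (X w * \1_B (Z j w))%:E = c * P (Z j @^-1` B).
  move=> mB.
  have mA' i : measurable (A' B i) by rewrite /A'; case: ifP.
  have gA' i : i != j -> g k (A' B) i = g k.+1 A i.
    move=> ij; rewrite /g /A' (negbTE ij) ltnS [in RHS]leq_eqVlt.
    suff -> : (i : nat) == k = false by [].
    by apply/negbTE; apply: contraNN ij => /eqP ik; apply/eqP/val_inj.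
  have := IH (ltnW kn) _ mA'; rewrite (bigD1 j)//=.
  have -> : \prod_(i | i != j) \int[P]_w (g k (A' B) i (Z i w))%:E = c.
    by apply: eq_bigr => i ij; rewrite gA'.
  have -> : \int[P]_w (\prod_i g k (A' B) i (Z i w))%:E =
      \int[P]_w (g k (A' B) j (Z j w) * X w)%:E.
    apply: eq_integral => w _; rewrite (bigD1 j)//=; congr (_ * _)%:E%R.
    by apply: eq_bigr => i ij; rewrite gA'.
  have -> : g k (A' B) j = \1_B by rewrite /g ltnn /A' eqxx.
  move=> H; transitivity (\int[P]_w (\1_B (Z j w) * X w)%:E).
    by apply: eq_integral => w _; rewrite mulrC.
  rewrite H muleC; congr (_ * _).
  have mZB : measurable (Z j @^-1` B) by rewrite -[X in measurable X]setTI; exact: mZ.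
  by rewrite -[in RHS](setIT (_ @^-1` _)) -integral_indic.
rewrite [RHS](bigD1 j)//= -/c.
under eq_integral => w _ do rewrite (bigD1 j)//= -/(X w).
have -> : g k.+1 A j = f j by rewrite /g ltnSn.
pose PX := mdensity P mX X0.
pose nu := measure_function_pushforward__canonical__measure_function_Measure PX (mZ j).
pose mu := measure_function_pushforward__canonical__measure_function_Measure P (mZ j).
have mEfj : measurable_fun setT (EFin \o f j) by exact/measurable_EFinP.
transitivity (\int[nu]_x (f j x)%:E).
  rewrite ge0_integral_pushforward//; last by move=> x _; rewrite lee_fin.
  rewrite preimage_setT [RHS](@ge0_integral_density _ _ _ P PX X)//.
  - exact: (measurableT_comp mEfj (mZ j)).
  - by move=> w /=; rewrite lee_fin.
rewrite (@ge0_integral_density _ _ _ mu nu (cst (fine c)))//; last 3 first.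
- by move=> x; rewrite /= fine_ge0.
- move=> B mB; rewrite (integral_cst mu mB (fine c)%:E) fineK// -XB//.
  rewrite /nu /= /pushforward /= /mdensity integral_mkcond.
  by apply: eq_integral => w _; rewrite epatch_indic EFinM indicE.
- by move=> x; rewrite lee_fin.
rewrite /= fineK// ge0_integralZr//; last by move=> x _; rewrite lee_fin.
by rewrite ge0_integral_pushforward//; move=> x _; rewrite lee_fin.
Qed.

End independence.

(** * Renyi divergence and the logistic model *)

Section renyi.
Local Open Scope ereal_scope.
Local Open Scope charge_scope.
Context disp (T : measurableType disp) (R : realType).

Lemma ae_eq_Radon_Nikodym_density (nu : {finite_measure set T -> \bar R})
    (mu : {sigma_finite_measure set T -> \bar R}) (f : T -> R) :
  measurable_fun setT f ->
  (forall A, measurable A -> nu A = \int[mu]_(x in A) (f x)%:E) ->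
  nu `<< mu ->
  ae_eq mu setT ('d (charge_of_finite_measure nu) '/d mu) (EFin \o f).
Proof.
move=> mf nuE numu; apply: integral_ae_eq => //.
- exact: Radon_Nikodym_integrable.
- exact/measurable_EFinP.
- by move=> E _ mE; rewrite -Radon_Nikodym_integral//= -nuE.
Qed.

(** The derivatives of [P] and [Q] against their sum are [p / g] and [q / g] with [g = p + q]. The
    exponents add up to 1, so the powers of [g] collect into one factor [1 / g], which cancels when
    passing from the sum to [M]. Positivity of [p] allows the division by [g] everywhere. *)
Lemma renyi_div_density (alpha : R) (P Q M : probability T R) (p q : T -> R) :
  measurable_fun setT p -> measurable_fun setT q ->
  (forall x, 0 < p x)%R -> (forall x, 0 <= q x)%R ->
  (forall A, measurable A -> P A = \int[M]_(x in A) (p x)%:E) ->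
  (forall A, measurable A -> Q A = \int[M]_(x in A) (q x)%:E) ->
  renyi_div alpha P Q = ((alpha - 1)^-1)%:E *
    lne (\int[M]_x (p x `^ alpha * q x `^ (1 - alpha))%:E).
Proof.
move=> mp mq p0 q0 PE QE; rewrite /renyi_div; congr (_ * lne _).
set mu := prob_add P Q.
pose g x := (p x + q x)%R.
have g0 x : (0 < g x)%R by rewrite /g ltr_pwDl.
have mg : measurable_fun setT g by exact: measurable_funD.
have mEp : measurable_fun setT (EFin \o p) by exact/measurable_EFinP.
have mEq : measurable_fun setT (EFin \o q) by exact/measurable_EFinP.
have muE A : measurable A -> mu A = \int[M]_(x in A) (g x)%:E.
  move=> mA; transitivity (P A + Q A); first by rewrite /mu /prob_add measure_addE.
  rewrite PE// QE// -ge0_integralD//.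
  - by move=> x _; rewrite lee_fin ltW.
  - exact: measurable_funTS.
  - by move=> x _; rewrite lee_fin.
  - exact: measurable_funTS.
have mginv : measurable_fun setT (fun x => (g x)^-1)%R.
  rewrite (_ : (fun _ => _) = (@powR R ^~ (-1)) \o g)%R.
    exact: (measurableT_comp (measurable_powR (-1))).
  by apply/funext => x /=; rewrite powR_inv1// ltW.
have changeE (h : T -> R) A : measurable_fun setT h -> (forall x, 0 <= h x)%R ->
    measurable A -> \int[mu]_(x in A) (h x / g x)%:E = \int[M]_(x in A) (h x)%:E.
  move=> mh h0 mA; rewrite [LHS]integral_mkcond [RHS]integral_mkcond.
  have hg0 x : (0 <= h x / g x)%R by rewrite divr_ge0// ltW.
  rewrite (@ge0_integral_density _ _ _ M mu g)//.
  - apply: eq_integral => x _; rewrite /patch; case: ifP => _; last by rewrite mul0e.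
    by rewrite -EFinM divfK// gt_eqF.
  - by move=> x; rewrite ltW.
  - apply/(measurable_restrictT _ mA); apply: measurable_funTS.
    by apply/measurable_EFinP; exact: measurable_funM.
  - by move=> x; rewrite /patch; case: ifP => _ //; rewrite lee_fin.
have muAE A : mu A = P A + Q A by rewrite /mu /prob_add measure_addE.
have Pmu : P `<< mu.
  apply/null_content_dominatesP => A mA muA0.
  have : P A + Q A == 0 by rewrite -muAE; apply/eqP; exact: muA0.
  by rewrite padde_eq0 ?measure_ge0// => /andP[/eqP].
have Qmu : Q `<< mu.
  apply/null_content_dominatesP => A mA muA0.
  have : P A + Q A == 0 by rewrite -muAE; apply/eqP; exact: muA0.
  by rewrite padde_eq0 ?measure_ge0// => /andP[_ /eqP].
have dPE : ae_eq mu setT ('d (charge_of_finite_measure P) '/d mu)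
    (EFin \o (fun x => p x / g x)%R).
  apply: ae_eq_Radon_Nikodym_density => //; first exact: measurable_funM.
  by move=> A mA; rewrite changeE//; [exact: PE|move=> x; exact: ltW].
have dQE : ae_eq mu setT ('d (charge_of_finite_measure Q) '/d mu)
    (EFin \o (fun x => q x / g x)%R).
  apply: ae_eq_Radon_Nikodym_density => //; first exact: measurable_funM.
  by move=> A mA; rewrite changeE//; exact: QE.
pose f x := (p x `^ alpha * q x `^ (1 - alpha))%R.
have mf : measurable_fun setT f.
  by apply: measurable_funM; exact: (measurableT_comp (measurable_powR _)).
rewrite -(changeE f)//; last by move=> x; rewrite mulr_ge0 ?powR_ge0.
apply: ae_eq_integral => //.
- apply: emeasurable_funM; apply: (measurableT_comp (measurable_poweR _)) => //;
  apply: measurable_int; exact: Radon_Nikodym_integrable.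
- by apply/measurable_EFinP; exact: measurable_funM.
apply: filterS2 dPE dQE => x dPx dQx _.
rewrite dPx// dQx//= -EFinM; congr EFin; rewrite /f.
have gi0 : (0 <= (g x)^-1)%R by rewrite invr_ge0 ltW.
rewrite !powRM// ?(ltW (p0 x))// mulrACA; congr (_ * _)%R.
rewrite -powRD; last by apply/implyP => _; rewrite gt_eqF ?invr_gt0.
by rewrite addrC subrK powRr1.
Qed.

End renyi.

Section logistic_model.
Context (R : realType) (d : nat).
Implicit Types (x theta : vec R d) (y : bool).

Lemma logit_pmf_gt0 theta y x : 0 < logit_pmf theta y x.
Proof. by rewrite divr_gt0 ?addr_gt0 ?expR_gt0. Qed.

Lemma logit_pmf_le1 theta y x : logit_pmf theta y x <= 1.
Proof. by rewrite ler_pdivrMr ?addr_gt0 ?expR_gt0// mul1r lerDr. Qed.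

(** Joint measurability in parameter and observation, as Tonelli over the prior and the sample space
    demands. The label is handled by a case split, and the inverse is written as the power -1, with
    which it agrees on nonnegative reals. *)
Lemma measurable_logit_pmf_joint disp (T : measurableType disp)
    (th : T -> vec R d) (z : T -> bool * vec R d) :
  measurable_fun setT th -> measurable_fun setT z ->
  measurable_fun setT (fun t => logit_pmf (th t) (z t).1 (z t).2).
Proof.
move=> mth mz.
have mz2 : measurable_fun setT (fun t => (z t).2).
  by apply: measurableT_comp => //; exact: measurable_snd.
have mz1 : measurable_fun setT (fun t => (z t).1).
  by apply: measurableT_comp => //; exact: measurable_fst.
pose F y (t : R) : R := expR (label R y * t) / (1 + expR (label R y * t)).
have mF y : measurable_fun setT (F y).
  rewrite (_ : F y = (fun t => expR (label R y * t) * ((1 + expR (label R y * t)) `^ (-1)))).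
    have me : measurable_fun setT (fun t => expR (label R y * t)).
      by apply: measurableT_comp => //; exact: measurable_funM.
    apply: measurable_funM => //; apply: (measurableT_comp (measurable_powR (-1))).
    exact: measurable_funD.
  by apply/funext => t; rewrite powR_inv1// addr_ge0 ?expR_ge0.
have mD : measurable_fun setT (fun t => dotv (z t).2 (th t)).
  apply: measurable_sum => i; apply: measurable_funM.
    exact: (measurableT_comp (@measurable_coord R d i) mz2).
  exact: (measurableT_comp (@measurable_coord R d i) mth).
rewrite (_ : (fun t => _) = fun t => if (z t).1 then F true (dotv (z t).2 (th t))
    else F false (dotv (z t).2 (th t))).
  by apply: measurable_fun_ifT => //; exact: (measurableT_comp (mF _) mD).
by apply/funext => t; rewrite /logit_pmf /F; case: (z t).1.
Qed.

Local Open Scope ereal_scope.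

Lemma ge0_integral_logit_model (m : probability (vec R d) R) theta
    (f : bool * vec R d -> \bar R) :
  measurable_fun setT f -> (forall z, 0 <= f z) ->
  \int[logit_model m theta]_z f z =
  \sum_(y : bool) \int[m]_x (f (y, x) * (logit_pmf theta y x)%:E).
Proof.
move=> mf f0.
have mpair y : measurable_fun setT (pair y : vec R d -> bool * vec R d).
  exact: measurable_pair1.
pose part y : {measure set (vec R d) -> \bar R} :=
  mdensity m (measurable_logit_pmf theta y) (logit_pmf_ge0 theta y).
pose q y := measure_function_pushforward__canonical__measure_function_Measure
  (part y) (mpair y).
transitivity (\int[measure_add (q true) (q false)]_z f z).
  apply: eq_measure_integral => A mA _.
  apply: eq_trans (esym (measure_addE (q true) (q false) A)).
  by rewrite /= /logit_model big_bool.
rewrite ge0_integral_measure_add// big_bool.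
have H y : \int[q y]_z f z = \int[m]_x (f (y, x) * (logit_pmf theta y x)%:E).
  rewrite ge0_integral_pushforward//.
  rewrite preimage_setT (@ge0_integral_density _ _ _ m _ (logit_pmf theta y))//.
  - exact: measurable_logit_pmf.
  - exact: logit_pmf_ge0.
  - exact: measurableT_comp.
  - by move=> x; exact: f0.
by rewrite !H.
Qed.

Definition logit_ratio theta theta' (z : bool * vec R d) : R :=
  logit_pmf theta z.1 z.2 / logit_pmf theta' z.1 z.2.

Lemma logit_ratio_gt0 theta theta' z : (0 < logit_ratio theta theta' z)%R.
Proof. by rewrite divr_gt0// logit_pmf_gt0. Qed.

Lemma measurable_logit_ratio disp (T : measurableType disp)
    (th th' : T -> vec R d) (z : T -> bool * vec R d) :
  measurable_fun setT th -> measurable_fun setT th' -> measurable_fun setT z ->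
  measurable_fun setT (fun t => logit_ratio (th t) (th' t) (z t)).
Proof.
move=> mth mth' mz.
rewrite (_ : (fun t => _) = fun t => logit_pmf (th t) (z t).1 (z t).2 *
    (logit_pmf (th' t) (z t).1 (z t).2) `^ (-1))%R.
  apply: measurable_funM; first exact: measurable_logit_pmf_joint.
  apply: (measurableT_comp (measurable_powR (-1))).
  exact: measurable_logit_pmf_joint.
by apply/funext => t; rewrite powR_inv1// logit_pmf_ge0.
Qed.

(** Both models share the design law [m], so for each label the factor [logit_pmf theta']
    contributed by the base model cancels the denominator of the ratio. *)
Lemma logit_model_density (m : probability (vec R d) R) theta theta' A :
  measurable A ->
  logit_model m theta A =
  \int[logit_model m theta']_(z in A) (logit_ratio theta theta' z)%:E.
Proof.
move=> mA; rewrite integral_mkcond ge0_integral_logit_model; last 2 first.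
- apply/(measurable_restrictT _ mA); apply: measurable_funTS.
  by apply/measurable_EFinP; exact: measurable_logit_ratio.
- move=> z; rewrite /patch; case: ifP => // _.
  by rewrite lee_fin ltW// logit_ratio_gt0.
apply: eq_bigr => y _; rewrite integral_mkcond; apply: eq_integral => x _.
rewrite /patch; have -> : (x \in [set x | A (y, x)]) = ((y, x) \in A).
  by apply/idP/idP => /set_mem h; apply/mem_set.
case: ifP => _; last by rewrite mul0e.
by rewrite -EFinM divfK// gt_eqF// logit_pmf_gt0.
Qed.

End logistic_model.

(** * Lower bound on prior integrals *)

Section lebesgue_vec_integrals.
Local Open Scope ereal_scope.
Context (R : realType).
Notation leb := (@lebesgue_measure R).

(** The image of Lebesgue measure under a translation gives half-open intervals their length, and
    this characterises Lebesgue measure. *)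
Lemma ge0_integral_lebesgue_translate (a : R) (f : R -> \bar R) :
  measurable_fun setT f -> (forall x, 0 <= f x) ->
  \int[leb]_x f (x - a)%R = \int[leb]_x f x.
Proof.
move=> mf f0.
pose phi (x : measurableTypeR R) : measurableTypeR R := (x - a)%R.
have mphi : measurable_fun setT phi by exact: measurable_funB.
pose mu := measure_function_pushforward__canonical__measure_function_Measure leb mphi.
transitivity (\int[mu]_x f x).
  by rewrite ge0_integral_pushforward.
apply: eq_measure_integral => A mA _; apply/esym/lebesgue_measure_unique => //= _ [[b c]] _ <-.
rewrite /mu/= /pushforward.
have -> : phi @^-1` `]b, c]%classic = `](b + a)%R, (c + a)%R]%classic.
  apply/seteqP; split => x /=; rewrite !in_itv/= /phi.
    by rewrite ltrBrDr lerBlDr.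
  by rewrite ltrBrDr lerBlDr.
rewrite !lebesgue_measure_itv/= !lte_fin ltrD2r; case: ifP => // _.
by rewrite -!EFinB opprD addrACA subrr addr0.
Qed.

(** In dimension [n.+1] the measure is by definition the image of a product measure under
    [vec_cons], so Tonelli splits off the head coordinate. In dimension 0 the Dirac mass integrates
    the empty product to 1. *)
Lemma ge0_integral_lebesgue_vec_prod n (f : 'I_n -> R -> R) :
  (forall i, measurable_fun setT (f i)) -> (forall i x, 0 <= f i x)%R ->
  \int[lebesgue_vec R n]_x (\prod_i f i (coord x i))%:E =
  \prod_i \int[leb]_x (f i x)%:E.
Proof.
elim: n f => [|n IH] f mf f0.
  rewrite big_ord0 (eq_integral (cst 1)); last by move=> x _; rewrite big_ord0.
  by rewrite integral_cst// mul1e /= diracT.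
have mG k (h : 'I_k -> R -> R) : (forall i, measurable_fun setT (h i)) ->
    measurable_fun setT (fun x : vec R k => (\prod_i h i (coord x i))%:E : \bar R).
  move=> mh; apply/measurable_EFinP; apply: measurable_prod => i _.
  exact: (measurableT_comp (mh i) (@measurable_coord R k i)).
have mE i : measurable_fun setT (fun x => (f i x)%:E : \bar R) by exact/measurable_EFinP.
have H0 k (h : 'I_k -> R -> R) (x : vec R k) : (forall i x, 0 <= h i x)%R ->
    0 <= (\prod_i h i (coord x i))%:E :> \bar R.
  by move=> h0; rewrite lee_fin; apply: prodr_ge0.
rewrite /= ge0_integral_pushforward//; last 3 first.
- exact: measurable_vec_cons.
- exact: mG.
- by move=> x _; exact: H0.
rewrite preimage_setT fubini_tonelli1/=; last 2 first.
- apply: measurableT_comp; first exact: mG.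
  exact: measurable_vec_cons.
- by move=> x; exact: H0.
rewrite /fubini_F big_ord_recl.
have E x (y : vec R n) : (\prod_i f i (coord (vec_cons (x, y)) i) =
    f ord0 x * \prod_i f (lift ord0 i) (coord y i))%R.
  rewrite big_ord_recl /coord /vec_cons tnth0; congr (_ * _)%R.
  by apply: eq_bigr => i _; rewrite tnthS.
under eq_integral => x _.
  under eq_integral => y _ do rewrite /= E EFinM.
  rewrite ge0_integralZl//; last 3 first.
  - exact: (mG n (fun i => f (lift ord0 i)) (fun i => mf _)).
  - by move=> y _; apply: (H0 n (fun i => f (lift ord0 i))).
  - by rewrite lee_fin.
  rewrite (IH (fun i => f (lift ord0 i)))//.
  over.
rewrite ge0_integralZr//; last 3 first.
- exact: (mE ord0).
- by move=> x _; rewrite lee_fin.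
- by apply: prode_ge0 => i _; apply: integral_ge0 => x _; rewrite lee_fin.
Qed.

End lebesgue_vec_integrals.

(** * One coordinate of the prior: mass and second moment *)

Section truncated_weight.
Context (R : realType) (tau c : R).
Hypotheses (tau_gt0 : 0 < tau) (c_gt0 : 0 < c).
Notation leb := (@lebesgue_measure R).

(** Up to scale and normalisation, the Student density with 3 degrees of freedom. Its second moment
    over the whole line is [tau ^+ 2] times its mass. *)
Definition cauchy_weight (u : R) : R := (tau ^+ 2 + u ^+ 2) ^- 2.

(** The cube of half-width [c] contains the l1 ball of radius [c], so products of truncated weights
    still dominate the prior weight, while all integrals run over a segment, where continuity gives
    integrability and the fundamental theorem of calculus applies. *)
Definition trunc_weight (u : R) : R := \1_(`[- c, c]%classic) u * cauchy_weight u.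

Let g_gt0 u : 0 < tau ^+ 2 + u ^+ 2.
Proof. by rewrite ltr_pwDl ?exprn_gt0// sqr_ge0. Qed.

Lemma cauchy_weight_gt0 u : 0 < cauchy_weight u.
Proof. by rewrite invr_gt0 exprn_gt0. Qed.

Lemma continuous_cauchy_weight : continuous cauchy_weight.
Proof.
move=> u; apply: cvgV; first by rewrite gt_eqF// exprn_gt0.
apply: (@continuous_comp _ _ _ (fun x : R => tau ^+ 2 + x ^+ 2) (fun x => x ^+ 2)).
  by apply: cvgD; [exact: cvg_cst|exact: exprn_continuous].
exact: exprn_continuous.
Qed.

Lemma measurable_cauchy_weight : measurable_fun setT cauchy_weight.
Proof. by apply: continuous_measurable_fun; exact: continuous_cauchy_weight. Qed.

Lemma trunc_weight_ge0 u : 0 <= trunc_weight u.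
Proof. by rewrite mulr_ge0 ?indicE// ltW// cauchy_weight_gt0. Qed.

Lemma trunc_weight_le u : trunc_weight u <= cauchy_weight u.
Proof.
rewrite /trunc_weight indicE; case: (_ \in _); rewrite ?mul1r// mul0r ltW//.
exact: cauchy_weight_gt0.
Qed.

Lemma measurable_trunc_weight : measurable_fun setT trunc_weight.
Proof.
apply: measurable_funM; last exact: measurable_cauchy_weight.
exact: measurable_indic.
Qed.

Let integrable_continuous (f : R -> R) : continuous f ->
  leb.-integrable `[- c, c] (EFin \o f).
Proof.
move=> cf; apply: continuous_compact_integrable; first exact: segment_compact.
exact: continuous_subspaceT.
Qed.

Lemma integral_trunc_weight (f : R -> R) :
  (\int[leb]_u (f u * trunc_weight u)%:E =
   \int[leb]_(u in `[(- c)%R, c]) (f u * cauchy_weight u)%:E)%E.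
Proof.
rewrite [RHS]integral_mkcond; apply: eq_integral => u _.
rewrite /patch /trunc_weight indicE; case: (_ \in _); first by rewrite mul1r.
by rewrite mul0r mulr0.
Qed.

Let continuous_sqrM : continuous (fun u : R => u ^+ 2 * cauchy_weight u).
Proof.
by move=> u; apply: cvgM; [exact: exprn_continuous|exact: continuous_cauchy_weight].
Qed.

Lemma integral_trunc_weight_fin_num : (\int[leb]_u (trunc_weight u)%:E)%E \is a fin_num.
Proof.
have := integral_trunc_weight (cst 1).
under eq_integral do rewrite mul1r.
move=> ->.
under eq_integral do rewrite mul1r.
by apply: integrable_fin_num => //; apply: integrable_continuous; exact: continuous_cauchy_weight.
Qed.

Lemma integral_trunc_weight_gt0 : (0 < \int[leb]_u (trunc_weight u)%:E)%E.
Proof.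
have := integral_trunc_weight (cst 1).
under eq_integral do rewrite mul1r.
move=> ->.
under eq_integral do rewrite mul1r.
(* On the segment the weight is smallest at the end points, where it equals [cauchy_weight c]. *)
apply: (@lt_le_trans _ _ (\int[leb]_(u in `[(- c)%R, c]) (cauchy_weight c)%:E)%E).
  rewrite integral_cst//= lebesgue_measure_itv/= lte_fin gtrN// -EFinD lte_fin.
  by rewrite mulr_gt0 ?cauchy_weight_gt0// opprK addr_gt0.
apply: ge0_le_integral => //.
- by move=> u _; rewrite lee_fin ltW// cauchy_weight_gt0.
- by apply/measurable_EFinP/measurable_funTS; exact: measurable_cauchy_weight.
- move=> u; rewrite /= in_itv/= => /andP[cu uc].
  rewrite lee_fin /cauchy_weight lef_pV2 ?posrE ?exprn_gt0//.
  by apply: lerXn2r; rewrite ?nnegrE ?(ltW (g_gt0 _))// lerD2l; nra.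
Qed.

(* -u / (tau^2 + u^2) is an antiderivative of (u^2 - tau^2) / (tau^2 + u^2)^2
   and is smaller at c than at - c. *)
Lemma integral_sqr_trunc_weight :
  (\int[leb]_u (u ^+ 2 * trunc_weight u)%:E <=
   (tau ^+ 2)%:E * \int[leb]_u (trunc_weight u)%:E)%E.
Proof.
pose f (u : R) := (u ^+ 2 - tau ^+ 2) * cauchy_weight u.
pose F (u : R) := - (u * (tau ^+ 2 + u ^+ 2)^-1).
have cf : continuous f.
  move=> u; apply: cvgM; last exact: continuous_cauchy_weight.
  by apply: cvgB; [exact: exprn_continuous|exact: cvg_cst].
have dF (u : R) : is_derive u 1 F (f u).
  have dg : is_derive u 1 (fun x : R => tau ^+ 2 + x ^+ 2) (2 * u).
    by apply: is_derive_eq; rewrite /GRing.scale/=; ring.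
  have dgV : is_derive u 1 (fun x : R => (tau ^+ 2 + x ^+ 2)^-1)
      (- (tau ^+ 2 + u ^+ 2) ^- 2 *: (2 * u)).
    by apply: is_deriveV; rewrite gt_eqF.
  have H := is_deriveN (is_deriveM (is_derive_id u 1) dgV).
  have E : - (u *: (- (tau ^+ 2 + u ^+ 2) ^- 2 *: (2 * u)) +
      (tau ^+ 2 + u ^+ 2)^-1 *: 1) = f u.
    rewrite /f /cauchy_weight /GRing.scale/=; field.
    by rewrite gt_eqF.
  by rewrite -E; exact: H.
have cF : continuous F.
  by move=> u; apply/differentiable_continuous/derivable1_diffP; case: (dF u).
have : (\int[leb]_(u in `[(- c)%R, c]) (f u)%:E = (F c)%:E - (F (- c))%:E)%E.
  apply: continuous_FTC2.
  - by rewrite gtrN.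
  - exact: continuous_subspaceT.
  - split.
    + by move=> u _; case: (dF u).
    + exact/cvg_at_right_filter/cF.
    + exact/cvg_at_left_filter/cF.
  - by move=> u _; rewrite derive1E; case: (dF u).
have fE : (\int[leb]_(u in `[(- c)%R, c]) (f u)%:E =
    \int[leb]_(u in `[(- c)%R, c]) (u ^+ 2 * cauchy_weight u)%:E -
    \int[leb]_(u in `[(- c)%R, c]) (tau ^+ 2 * cauchy_weight u)%:E)%E.
  rewrite -integralB_EFin//.
  - by apply: eq_integral => u _; rewrite /f mulrBl.
  - exact: integrable_continuous.
  - apply: integrable_continuous => u; apply: cvgM; first exact: cvg_cst.
    exact: continuous_cauchy_weight.
rewrite fE -!integral_trunc_weight.
have -> : (\int[leb]_u (tau ^+ 2 * trunc_weight u)%:E =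
    (tau ^+ 2)%:E * \int[leb]_u (trunc_weight u)%:E)%E.
  under eq_integral do rewrite EFinM.
  rewrite ge0_integralZl//.
  - by apply/measurable_EFinP; exact: measurable_trunc_weight.
  - by move=> u _; rewrite lee_fin trunc_weight_ge0.
  - by rewrite lee_fin sqr_ge0.
move=> H; rewrite -sube_le0 ?H.
  rewrite -EFinB lee_fin /F sqrrN mulNr opprK -opprD oppr_le0 addr_ge0//.
    by rewrite divr_ge0// ltW.
  by rewrite divr_ge0// ltW.
Qed.

End truncated_weight.

(** * Prior integrals near a sparse parameter *)

Section prior_lower_bound.
Context (R : realType) (d : nat) (tau c N : R).
Hypotheses (tau_gt0 : 0 < tau) (c_gt0 : 0 < c) (N_gt0 : 0 < N).
Hypothesis d_tau : d%:R * tau ^+ 2 = N ^- 2.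
Notation leb := (@lebesgue_measure R).
Notation lebv := (lebesgue_vec R d).
Implicit Types a th : vec R d.

Definition sqdist th a : R := \sum_i (coord th i - coord a i) ^+ 2.

Definition shifted_weight th a : R :=
  \prod_i trunc_weight tau c (coord th i - coord a i).

(* Bounds the ratio of the translated prior weight to the prior weight; its
   logarithm is the dimension-dependent part of the rate. *)
Definition tail_factor a : R := \prod_i (1 + `|coord a i| / tau) ^+ 4.

Lemma sqdist_ge0 th a : 0 <= sqdist th a.
Proof. by apply: sumr_ge0 => i _; exact: sqr_ge0. Qed.

Lemma tail_factor_gt0 a : 0 < tail_factor a.
Proof.
by apply: prodr_gt0 => i _; rewrite exprn_gt0// ltr_pwDl// divr_ge0// ltW.
Qed.

Lemma shifted_weight_ge0 th a : 0 <= shifted_weight th a.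
Proof. by apply: prodr_ge0 => i _; exact: trunc_weight_ge0. Qed.

Lemma measurable_sqdist a : measurable_fun setT (sqdist ^~ a).
Proof.
apply: measurable_sum => i; apply: measurable_funX; apply: measurable_funB => //.
exact: measurable_coord.
Qed.

Lemma measurable_shifted_weight a : measurable_fun setT (shifted_weight ^~ a).
Proof.
apply: measurable_prod => i _; apply: (measurableT_comp (measurable_trunc_weight c tau_gt0)).
by apply: measurable_funB => //; exact: measurable_coord.
Qed.

Local Open Scope ereal_scope.

(** Plays two parts: it is the mass of every translate of the product weight, and it bounds the
    normalising constant of the prior from above. It therefore disappears from the final bound
    without being computed. *)
Definition weight_mass : \bar R := \prod_(i < d) \int[leb]_u (trunc_weight tau c u)%:E.

Lemma weight_mass_fin_num : weight_mass \is a fin_num.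
Proof.
apply: (big_ind (fun x : \bar R => x \is a fin_num)) => // [x y|i _].
  exact: fin_numM.
exact: integral_trunc_weight_fin_num.
Qed.

Lemma weight_mass_gt0 : 0 < weight_mass.
Proof.
apply: (big_ind (fun x : \bar R => 0 < x)) => // [x y|i _]; first exact: mule_gt0.
exact: integral_trunc_weight_gt0.
Qed.

Lemma integral_shifted_weight a :
  \int[lebv]_th (shifted_weight th a)%:E = weight_mass.
Proof.
have mw := measurable_trunc_weight c tau_gt0.
rewrite (ge0_integral_lebesgue_vec_prod (f := fun i u => trunc_weight tau c (u - coord a i)))//.
- apply: eq_bigr => i _.
  rewrite (@ge0_integral_lebesgue_translate _ _ (fun u => (trunc_weight tau c u)%:E))//.
  + exact/measurable_EFinP.
  + by move=> u; rewrite lee_fin trunc_weight_ge0.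
- by move=> i; apply: (measurableT_comp mw); exact: measurable_funB.
- by move=> i u; exact: trunc_weight_ge0.
Qed.

(** Each of the [d] squares involves a single coordinate, so its integral factorises: that
    coordinate costs a factor [tau ^+ 2] by the one-dimensional bound and the others contribute
    their mass. The function [h i j] carries the square only when [j] is [i]. *)
Lemma integral_sqdist_shifted_weight a :
  \int[lebv]_th (sqdist th a * shifted_weight th a)%:E <=
  (d%:R * tau ^+ 2)%:E * weight_mass.
Proof.
have mw := measurable_trunc_weight c tau_gt0.
pose h (i j : 'I_d) (u : R) : R :=
  ((if j == i then u ^+ 2 else 1) * trunc_weight tau c u)%R.
have h0 i j u : (0 <= h i j u)%R.
  by rewrite mulr_ge0 ?trunc_weight_ge0//; case: ifP; rewrite ?sqr_ge0.
have mh i j : measurable_fun setT (h i j).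
  by apply: measurable_funM => //; case: (j == i) => //; exact: measurable_funX.
pose H i th : R := (\prod_j h i j (coord th j - coord a j))%R.
have H0 i th : (0 <= H i th)%R by apply: prodr_ge0.
have mH i : measurable_fun setT (H i).
  apply: measurable_prod => j _; apply: (measurableT_comp (mh i j)).
  by apply: measurable_funB => //; exact: measurable_coord.
under eq_integral => th _.
  rewrite /sqdist mulr_suml; rewrite (eq_bigr (fun i => H i th)); last first.
    move=> i _; rewrite /H /shifted_weight (bigD1 i)//= [in RHS](bigD1 i)//= mulrA.
    rewrite {1}/h eqxx; congr (_ * _)%R; apply: eq_bigr => j ji.
    by rewrite /h (negbTE ji) mul1r.
  rewrite -sumEFin.
  over.
rewrite ge0_integral_sum//; last 2 first.
- by move=> i; apply/measurable_EFinP; exact: mH.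
- by move=> i th _; rewrite lee_fin.
rewrite [leRHS](_ : _ = \sum_(i < d) ((tau ^+ 2)%:E * weight_mass)); last first.
  rewrite -(fineK weight_mass_fin_num) -!EFinM sumEFin sumr_const card_ord.
  by rewrite -[in RHS]mulr_natl mulrA.
apply: lee_sum => i _.
rewrite (ge0_integral_lebesgue_vec_prod (f := fun j u => h i j (u - coord a j)%R))//; last first.
  by move=> j; apply: (measurableT_comp (mh i j)); exact: measurable_funB.
rewrite (eq_bigr (fun j => \int[leb]_u (h i j u)%:E)); last first.
  move=> j _; rewrite (@ge0_integral_lebesgue_translate _ _ (fun u => (h i j u)%:E))//.
  + exact/measurable_EFinP.
  + by move=> u; rewrite lee_fin.
rewrite /weight_mass (bigD1 i)//= [in leRHS](bigD1 i)//= muleA.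
have -> : \prod_(j | j != i) \int[leb]_u (h i j u)%:E =
    \prod_(j | j != i) \int[leb]_u (trunc_weight tau c u)%:E.
  apply: eq_bigr => j ji; apply: eq_integral => u _.
  by rewrite /h (negbTE ji) mul1r.
apply: lee_wpmul2r.
  by apply: prode_ge0 => j _; apply: integral_ge0 => u _; rewrite lee_fin trunc_weight_ge0.
rewrite /h eqxx; exact: integral_sqr_trunc_weight.
Qed.

Lemma prior_weight_le th : (prior_weight c tau th <= \prod_i trunc_weight tau c (coord th i))%R.
Proof.
rewrite /prior_weight indicE; have [/set_mem thc|] := boolP (_ \in _); last first.
  by rewrite mul0r => _; apply: prodr_ge0 => i _; exact: trunc_weight_ge0.
rewrite mul1r; apply: ler_prod => i _; rewrite /trunc_weight indicE mem_set ?mul1r.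
  by rewrite /cauchy_weight lexx ltW// cauchy_weight_gt0.
rewrite /= in_itv/= -ler_norml; apply: le_trans thc.
by rewrite /norm1 (bigD1 i)//= lerDl; apply: sumr_ge0.
Qed.

(** With [x = |b| / tau] and [v = u - b], the claim is the square of [tau ^+ 2 + u ^+ 2 <= (1 + x)
    ^+ 2 * (tau ^+ 2 + v ^+ 2)]. Expanding [u = v + b], the cross term is controlled by
    [2 |v| tau <= v ^+ 2 + tau ^+ 2]. *)
Lemma cauchy_weight_shift (u b : R) :
  (cauchy_weight tau (u - b) <= (1 + `|b| / tau) ^+ 4 * cauchy_weight tau u)%R.
Proof.
set x := (`|b| / tau)%R; set v := (u - b)%R.
have x0 : (0 <= x)%R by rewrite divr_ge0// ltW.
have xtau : (x * tau = `|b|)%R by rewrite divfK// gt_eqF.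
have g0 r : (0 < tau ^+ 2 + r ^+ 2)%R by rewrite ltr_pwDl ?exprn_gt0// sqr_ge0.
rewrite /cauchy_weight -/v ler_pdivlMr ?exprn_gt0// mulrC ler_pdivrMr ?exprn_gt0//.
rewrite (_ : 4 = 2 * 2)%N// exprM -exprMn.
apply: lerXn2r; rewrite ?nnegrE ?(ltW (g0 _))//.
  by apply: mulr_ge0; [exact: sqr_ge0|exact: ltW].
have b2 : (b ^+ 2 = x ^+ 2 * tau ^+ 2)%R by rewrite -exprMn xtau real_normK ?num_real.
have vb : (v * b <= `|v| * tau * x)%R.
  by rewrite -mulrA [(tau * x)%R]mulrC xtau -normrM ler_norm.
have v2 : (`|v| ^+ 2 = v ^+ 2)%R by rewrite real_normK ?num_real.
have -> : (u ^+ 2 = v ^+ 2 + 2 * (v * b) + b ^+ 2)%R by rewrite /v; ring.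
have vtau : (2 * (`|v| * tau) <= v ^+ 2 + tau ^+ 2)%R.
  have := sqr_ge0 (`|v| - tau)%R.
  by rewrite sqrrB v2 -mulr_natl; lra.
have : (2 * (`|v| * tau) * x <= (v ^+ 2 + tau ^+ 2) * x)%R by exact: ler_wpM2r.
have : (0 <= x ^+ 2 * v ^+ 2)%R by rewrite mulr_ge0 ?sqr_ge0.
have : (0 <= x * v ^+ 2)%R by rewrite mulr_ge0 ?sqr_ge0.
have : (0 <= x * tau ^+ 2)%R by rewrite mulr_ge0 ?sqr_ge0.
by rewrite b2; lra.
Qed.

(** The margin [2 * d%:R * tau] left between [norm1 a] and [c] is exactly the allowed l1 distance,
    so [th] stays in the ball and the indicator in the prior weight equals 1. The factors are then
    compared coordinate by coordinate. *)
Lemma shifted_weight_le th a : (norm1 a <= c - 2 * d%:R * tau)%R ->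
  (\sum_i `|coord th i - coord a i| <= 2 * d%:R * tau)%R ->
  (shifted_weight th a <= tail_factor a * prior_weight c tau th)%R.
Proof.
move=> ac tha.
have thc : (norm1 th <= c)%R.
  apply: (@le_trans _ _ (\sum_i (`|coord th i - coord a i| + `|coord a i|))%R).
    by apply: ler_sum => i _; apply: le_trans (ler_normD _ _); rewrite subrK.
  by rewrite big_split/= -[X in (_ + X <= _)%R]/(norm1 a); lra.
rewrite /prior_weight indicE mem_set// mul1r /tail_factor -big_split/=.
apply: ler_prod => i _; rewrite trunc_weight_ge0//=.
exact: le_trans (trunc_weight_le _ _ _) (cauchy_weight_shift _ _).
Qed.

(* Let v = N^2 * sqdist th a, whose mean under the translated weight is at most 1.
   If the l1 distance from th to a exceeds 2 * d * tau then v > 3, and the last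
   term alone suffices; otherwise th lies in the l1 ball of radius c and the
   tangent of exp at -2 * t / N is used. Since 3/4 - 1/4 = 1/2, integration
   loses only a factor 2. *)
Lemma trunc_weight_pointwise (t : R) th a : (0 <= t)%R ->
  (norm1 a <= c - 2 * d%:R * tau)%R ->
  (expR (- (2 * t / N)) * (3 / 4 + t / N) * shifted_weight th a <=
   tail_factor a * (expR (- (t * Num.sqrt (sqdist th a))) * prior_weight c tau th) +
   expR (- (2 * t / N)) * (1 / 4 + t / N) * N ^+ 2 *
     (sqdist th a * shifted_weight th a))%R.
Proof.
move=> t0 ac; set e := expR (- (2 * t / N)); set W := shifted_weight th a.
set S := sqdist th a; set T := (t / N)%R.
have e0 : (0 < e)%R by exact: expR_gt0.
have W0 : (0 <= W)%R by exact: shifted_weight_ge0.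
have S0 : (0 <= S)%R by exact: sqdist_ge0.
have T0 : (0 <= T)%R by rewrite divr_ge0// ltW.
have [tha|tha] := leP (\sum_i `|coord th i - coord a i|)%R (2 * d%:R * tau)%R.
  have Wle := shifted_weight_le ac tha.
  set r := (N * Num.sqrt S)%R.
  have r0 : (0 <= r)%R by rewrite mulr_ge0 ?sqrtr_ge0// ltW.
  have tr : (t * Num.sqrt S = T * r)%R.
    by rewrite /T /r; field; rewrite gt_eqF.
  have r2 : (r ^+ 2 = N ^+ 2 * S)%R by rewrite exprMn sqr_sqrtr.
  have eE : (e * (1 + (2 * T - T * r)) <= expR (- (t * Num.sqrt S)))%R.
    rewrite tr [X in expR X](_ : _ = - (2 * t / N) + (2 * T - T * r))%R; last first.
      by rewrite /T; ring.
    by rewrite expRD ler_pM2l// expR_ge1Dx.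
  apply: (@le_trans _ _ (expR (- (t * Num.sqrt S)) * W +
      e * (1 / 4 + T) * N ^+ 2 * (S * W))%R); last first.
    rewrite lerD2r mulrCA ler_wpM2l ?expR_ge0//.
  rewrite (_ : _ * (S * W) = e * (1 / 4 + T) * (N ^+ 2 * S) * W)%R; last by ring.
  rewrite -r2 -mulrDl ler_wpM2r//.
  apply: (le_trans _ (lerD eE (lexx _))).
  rewrite -[X in (_ <= _ + X)%R]mulrA -mulrDr ler_pM2l//.
  (* After division by [e], what remains is nonnegativity of
     [(1 + r ^+ 2) / 4 + T * (r ^+ 2 - r + 1)]. *)
  have : (0 <= T * (r ^+ 2 - r + 1))%R.
    by rewrite mulr_ge0//; have := sqr_ge0 (r - 1)%R; rewrite sqrrB; lra.
  by have := sqr_ge0 r; lra.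
apply: (@le_trans _ _ (e * (1 / 4 + T) * N ^+ 2 * (S * W))%R); last first.
  rewrite lerDr mulr_ge0 ?(ltW (tail_factor_gt0 _))// mulr_ge0 ?expR_ge0//.
  exact: prior_weight_ge0.
(* Summing [|z| tau <= (z ^+ 2 + tau ^+ 2) / 2] over the coordinates turns an l1 distance above
   [2 d tau] into [S >= 3 d tau ^+ 2], that is, [N ^+ 2 * S >= 3]. This 3 is the ratio of the
   constants 3/4 and 1/4. *)
have tS : (3 * (d%:R * tau ^+ 2) <= S)%R.
  have : (\sum_i `|coord th i - coord a i| * tau <= (S + d%:R * tau ^+ 2) / 2)%R.
    rewrite (_ : d%:R * tau ^+ 2 = \sum_(i < d) tau ^+ 2)%R; last first.
      by rewrite sumr_const card_ord mulr_natl.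
    rewrite /S /sqdist -big_split/= mulr_suml; apply: ler_sum => i _.
    set z := (coord th i - coord a i)%R.
    have := sqr_ge0 (`|z| - tau)%R.
    by rewrite sqrrB real_normK ?num_real// -mulr_natl; lra.
  rewrite -mulr_suml => h.
  have : (2 * d%:R * tau * tau <= (S + d%:R * tau ^+ 2) / 2)%R.
    by apply: le_trans h; rewrite ler_pM2r// ltW.
  by rewrite -mulrA -expr2; lra.
have N2 : (0 < N ^+ 2)%R by rewrite exprn_gt0.
have NS : (3 <= N ^+ 2 * S)%R.
  rewrite (_ : 3 = N ^+ 2 * (3 * (d%:R * tau ^+ 2)))%R; last first.
    by rewrite d_tau; field; rewrite gt_eqF.
  by rewrite ler_pM2l.
rewrite (_ : _ * (S * W) = e * (1 / 4 + T) * (N ^+ 2 * S) * W)%R; last by ring.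
rewrite ler_wpM2r// -[leRHS]mulrA ler_pM2l//.
by nra.
Qed.

(** Integration of the pointwise inequality. Since [d_tau] bounds the second moment by
    [weight_mass / N ^+ 2], the gain is [A - B / N ^+ 2 = e / 2]; this half becomes the [ln 2] of
    the rate. [G] stands for a normalised likelihood, of which only the decay in the distance to [a]
    matters. *)
Lemma prior_weight_lower_bound (t : R) (a : vec R d) (G : vec R d -> R) :
  (0 <= t)%R -> (norm1 a <= c - 2 * d%:R * tau)%R ->
  measurable_fun setT G ->
  (forall th, expR (- (t * Num.sqrt (sqdist th a))) <= G th)%R ->
  (expR (- (2 * t / N)) / (2 * tail_factor a))%:E * weight_mass <=
  \int[lebv]_th (G th * prior_weight c tau th)%:E.
Proof.
move=> t0 ac mG HG.
have G0 th : (0 <= G th)%R by apply: le_trans (HG th); exact: expR_ge0.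
set e := expR (- (2 * t / N)).
have e0 : (0 < e)%R by exact: expR_gt0.
have tN : (0 <= t / N)%R by rewrite divr_ge0// ltW.
pose A : R := (e * (3 / 4 + t / N))%R.
pose B : R := (e * (1 / 4 + t / N) * N ^+ 2)%R.
have A0 : (0 <= A)%R by rewrite mulr_ge0 ?(ltW e0)// addr_ge0.
have B0 : (0 <= B)%R by rewrite mulr_ge0 ?sqr_ge0// mulr_ge0 ?(ltW e0)// addr_ge0.
have E0 := tail_factor_gt0 a.
have mpw := @measurable_prior_weight R d c tau.
have mGp : measurable_fun setT (fun th => (G th * prior_weight c tau th)%:E : \bar R).
  by apply/measurable_EFinP; exact: measurable_funM.
have Gp0 th : (0 <= G th * prior_weight c tau th)%R.
  by rewrite mulr_ge0// prior_weight_ge0.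
have mW := measurable_shifted_weight a.
have mvW : measurable_fun setT (fun th => (sqdist th a * shifted_weight th a)%:E : \bar R).
  apply/measurable_EFinP; apply: measurable_funM => //; exact: measurable_sqdist.
have vW0 th : (0 <= sqdist th a * shifted_weight th a)%R.
  by rewrite mulr_ge0 ?sqdist_ge0 ?shifted_weight_ge0.
have : \int[lebv]_th (A * shifted_weight th a)%:E <=
    \int[lebv]_th ((tail_factor a)%:E * (G th * prior_weight c tau th)%:E +
                   B%:E * (sqdist th a * shifted_weight th a)%:E).
  apply: ge0_le_integral => //.
  - by move=> th _; rewrite lee_fin mulr_ge0 ?shifted_weight_ge0.
  - by apply/measurable_EFinP; exact: measurable_funM.
  - by apply: emeasurable_funD; exact: emeasurable_funM.
  - move=> th _; rewrite -!EFinM -EFinD lee_fin.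
    apply: le_trans (trunc_weight_pointwise th t0 ac) _.
    rewrite lerD2r ler_pM2l// ler_wpM2r//.
    exact: prior_weight_ge0.
under eq_integral do rewrite EFinM.
rewrite ge0_integralZl//; last 2 first.
- exact/measurable_EFinP.
- by move=> th _; rewrite lee_fin shifted_weight_ge0.
rewrite integral_shifted_weight ge0_integralD//; last 4 first.
- by move=> th _; rewrite -EFinM lee_fin mulr_ge0// ltW.
- exact: emeasurable_funM.
- by move=> th _; rewrite -EFinM lee_fin mulr_ge0.
- exact: emeasurable_funM.
rewrite !ge0_integralZl//; last 3 first.
- by move=> th _; rewrite lee_fin.
- by move=> th _; rewrite lee_fin.
- by rewrite lee_fin ltW.
set I := \int[_]_th (G th * prior_weight c tau th)%:E.
move=> H.
have BM : B%:E * \int[lebv]_th (sqdist th a * shifted_weight th a)%:E <=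
    (B / N ^+ 2)%:E * weight_mass.
  rewrite [(B / N ^+ 2)%:E]EFinM -[leRHS]muleA; apply: lee_wpmul2l; first by rewrite lee_fin.
  by rewrite -d_tau; exact: integral_sqdist_shifted_weight.
have {}H : A%:E * weight_mass <= (tail_factor a)%:E * I + (B / N ^+ 2)%:E * weight_mass.
  by apply: le_trans H _; exact: leeD2l.
have Mfin := weight_mass_fin_num.
have I0 : 0 <= I by apply: integral_ge0 => th _; rewrite lee_fin.
have [->|] := eqVneq I +oo; first by rewrite leey.
move=> Ioo; have Ifin : I \is a fin_num by rewrite ge0_fin_numE// ltey.
move: H; rewrite -(fineK Mfin) -(fineK Ifin) -!EFinM -EFinD !lee_fin.
set m := fine weight_mass; set I' := fine I.
have -> : (B / N ^+ 2 = e * (1 / 4 + t / N))%R by rewrite /B mulfK// gt_eqF// exprn_gt0.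
rewrite /A => H.
rewrite mulrAC ler_pdivrMr ?mulr_gt0//.
by lra.
Qed.

(** Normalising the prior preserves the bound, because its normalising constant is at most
    [weight_mass]. *)
Lemma prior_lower_bound (t : R) (a : vec R d) (G : vec R d -> R) :
  (0 <= t)%R -> (norm1 a <= c - 2 * d%:R * tau)%R ->
  measurable_fun setT G ->
  (forall th, expR (- (t * Num.sqrt (sqdist th a))) <= G th)%R ->
  (expR (- (2 * t / N)) / (2 * tail_factor a))%:E <=
  \int[prior d c tau]_th (G th)%:E.
Proof.
move=> t0 ac mG HG.
have G0 th : (0 <= G th)%R by apply: le_trans (HG th); exact: expR_ge0.
have lb := prior_weight_lower_bound t0 ac mG HG.
set k := (expR (- (2 * t / N)) / (2 * tail_factor a))%R in lb *.
have k0 : (0 < k)%R by rewrite divr_gt0 ?expR_gt0// mulr_gt0// tail_factor_gt0.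
pose mu := mdensity lebv (measurable_prior_weight c tau) (prior_weight_ge0 c tau).
have muT : mu setT = \int[lebv]_th (prior_weight c tau th)%:E by [].
have mpw : measurable_fun setT (fun th : vec R d => (prior_weight c tau th)%:E : \bar R).
  by apply/measurable_EFinP; exact: measurable_prior_weight.
have mu_le : mu setT <= weight_mass.
  rewrite muT -(integral_shifted_weight [tuple of nseq d 0%R]).
  apply: ge0_le_integral => //.
  - by move=> th _; rewrite lee_fin prior_weight_ge0.
  - by apply/measurable_EFinP; exact: measurable_shifted_weight.
  - move=> th _; rewrite lee_fin /shifted_weight.
    under eq_bigr do rewrite {2}/coord tnth_nseq subr0.
    exact: prior_weight_le.
(* Positivity of the normalising constant is the previous bound for [G = 1] and [t = 0]. Together
   with finiteness it keeps [mnormalize] out of its default branch. *)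
have mu_gt0 : 0 < mu setT.
  have H1 th : (expR (- (0 * Num.sqrt (sqdist th a))) <= cst 1 th)%R.
    by rewrite mul0r oppr0 expR0.
  have := prior_weight_lower_bound (lexx 0%R) ac (measurable_cst _) H1.
  under eq_integral do rewrite mul1r.
  rewrite -muT; apply: lt_le_trans; rewrite mule_gt0 ?weight_mass_gt0//.
  by rewrite lte_fin divr_gt0 ?expR_gt0// mulr_gt0// tail_factor_gt0.
have Mfin := weight_mass_fin_num.
have mufin : mu setT \is a fin_num.
  by rewrite ge0_fin_numE ?(ltW mu_gt0)// (le_lt_trans mu_le)// ltey_eq Mfin.
rewrite /prior (@ge0_integral_mnormalize _ _ _ mu)//; last 3 first.
- by rewrite gt_eqF.
- by move: mufin; rewrite fin_numE => /andP[].
- exact/measurable_EFinP.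
rewrite (@ge0_integral_density _ _ _ lebv mu (prior_weight c tau))//; last 3 first.
- exact: measurable_prior_weight.
- exact: prior_weight_ge0.
- exact/measurable_EFinP.
have mf0 : (0 < fine (mu setT))%R by rewrite fine_gt0// mu_gt0 ltey_eq mufin.
rewrite muleC lee_pdivlMr//.
apply: le_trans lb; rewrite lee_wpmul2l ?lee_fin ?(ltW k0)//.
by rewrite fineK.
Qed.

(** The inequality of arithmetic and geometric means on the support of [a], obtained by multiplying
    the tangent bounds [1 + x i <= C * expR ((1 + x i) / C - 1)]. The exponents sum to at most 0
    because [s + norm1 a / tau <= s + c / tau - 2 d], which is at most [c / tau = s C] as
    [s <= d]. *)
Lemma tail_factor_le a : (norm1 a <= c - 2 * d%:R * tau)%R ->
  (tail_factor a <= (c / tau / (norm0 a)%:R) ^+ (4 * norm0 a))%R.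
Proof.
move=> ac; set s := norm0 a; set C := (c / tau / s%:R)%R.
pose x i := (`|coord a i| / tau)%R.
have x0 i : (0 <= x i)%R by rewrite divr_ge0// ltW.
pose S := [set i | coord a i != 0%R]%SET.
have sE : s = #|S|.
  apply: eq_card => i; rewrite inE; apply/idP/idP; first by move/set_mem.
  by move=> h; exact/mem_set.
have tailE : tail_factor a = ((\prod_(i in S) (1 + x i)) ^+ 4)%R.
  rewrite /tail_factor prodrXl; congr (_ ^+ 4)%R.
  rewrite (bigID (mem S))/= [X in (_ * X)%R]big1 ?mulr1// => i.
  by rewrite inE negbK => /eqP ai; rewrite ai normr0 mul0r addr0.
(* For [s = 0] the base is a quotient by 0, hence 0, but the exponent is 0 as well and both sides
   equal 1. *)
have [s0|s0] := posnP s.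
  rewrite tailE s0 muln0 expr0 (_ : S = finset.set0) ?big_set0 ?expr1n//.
  by apply/eqP; rewrite -cards_eq0 -sE s0.
have sR : (0 < s%:R :> R)%R by rewrite ltr0n.
have C0 : (0 < C)%R by rewrite !divr_gt0.
have sC : (s%:R * C = c / tau)%R by rewrite /C mulrC divfK// gt_eqF.
rewrite tailE mulnC exprM; apply: lerXn2r; rewrite ?nnegrE ?exprn_ge0 ?(ltW C0)//.
  by apply: prodr_ge0 => i _; rewrite addr_ge0.
apply: (@le_trans _ _ (\prod_(i in S) (C * expR ((1 + x i) / C - 1)))%R).
  apply: ler_prod => i _; rewrite addr_ge0//=.
  have := expR_ge1Dx ((1 + x i) / C - 1)%R.
  by rewrite addrC subrK ler_pdivrMr// mulrC.
rewrite big_split/= prodr_const -sE -[leRHS]mulr1 ler_wpM2l ?exprn_ge0 ?(ltW C0)//.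
rewrite -expR_sum -[leRHS]expR0 ler_expR big_split/= -mulr_suml sumrN sumr_const -sE.
rewrite subr_le0 ler_pdivrMr// sC big_split/= sumr_const -sE.
have sd : (s%:R <= d%:R :> R)%R by rewrite ler_nat sE (leq_trans (max_card _))// card_ord.
have : (\sum_(i in S) x i <= norm1 a / tau)%R.
  rewrite /norm1 mulr_suml [leRHS](bigID (mem S))/= lerDl.
  by apply: sumr_ge0 => i _; exact: x0.
have : (norm1 a / tau <= c / tau - 2 * d%:R)%R.
  by rewrite ler_pdivrMr// mulrBl divfK// gt_eqF.
have : (0 <= d%:R :> R)%R by rewrite ler0n.
by lra.
Qed.

End prior_lower_bound.

(** * Kullback-Leibler divergence and affinity *)

Section integral_bounds.
Local Open Scope ereal_scope.
Context disp (T : measurableType disp) (R : realType).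

(** The term [B] has no sign. Its negative part is moved to the left, which leaves an inequality
    between integrals of nonnegative functions, and is then subtracted, its integral being finite;
    [f] and [V] may have infinite integrals. *)
Lemma ae_ge0_le_integral_add (mu : {measure set T -> \bar R})
    (f V : T -> \bar R) (B : T -> R) :
  measurable_fun setT f -> (forall x, 0 <= f x) ->
  measurable_fun setT V -> (forall x, 0 <= V x) ->
  mu.-integrable setT (EFin \o B) ->
  {ae mu, forall x, f x <= V x + (B x)%:E} ->
  \int[mu]_x f x <= \int[mu]_x V x + \int[mu]_x (B x)%:E.
Proof.
move=> mf f0 mV V0 iB fVB.
have mB := measurable_int _ iB.
pose Bp := (EFin \o B)^\+; pose Bn := (EFin \o B)^\-.
have Bp0 x : 0 <= Bp x by exact: funepos_ge0.
have Bn0 x : 0 <= Bn x by exact: funeneg_ge0.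
have mBp : measurable_fun setT Bp by exact: measurable_funepos.
have mBn : measurable_fun setT Bn by exact: measurable_funeneg.
have H : \int[mu]_x (f x + Bn x) <= \int[mu]_x (V x + Bp x).
  apply: ae_ge0_le_integral => //.
  - by move=> x _; exact: adde_ge0.
  - exact: emeasurable_funD.
  - by move=> x _; exact: adde_ge0.
  - exact: emeasurable_funD.
  apply: filterS fVB => x fx _.
  have Bfin : Bn x \is a fin_num by rewrite /Bn funenegE /=; case: leP.
  rewrite -leeBrDr// -addeA.
  suff -> : Bp x - Bn x = (B x)%:E by [].
  by rewrite -[RHS]/((EFin \o B) x) [in RHS](funeposneg (EFin \o B)).
rewrite ge0_integralD// in H; rewrite ge0_integralD// in H.
rewrite [X in _ + X]integralE -/Bp -/Bn.
have Bnfin : \int[mu]_x Bn x \is a fin_num by apply: integrable_neg_fin_num.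
by rewrite addeA leeBrDr.
Qed.

Lemma ln_le_tangent (y c : R) : (0 < y)%R -> (0 < c)%R -> (ln y <= y / c + (ln c - 1))%R.
Proof.
move=> y0 c0; have yc : (0 < y / c)%R by exact: divr_gt0.
have -> : ln y = (ln (y / c) + ln c)%R.
  by rewrite -lnM ?posrE// divfK// gt_eqF.
rewrite [leRHS]addrA [leRHS]addrAC lerD2r lerBrDr -ler_expR expRD lnK ?posrE//.
have := expR_ge1Dx (y / c - 1)%R; rewrite addrC subrK => H.
have := ler_wpM2r (expR_ge0 1) H; by rewrite -expRD subrK.
Qed.

(** Jensen's inequality for [ln] would correspond to [c] equal to the mean of [y]. Leaving [c] free
    allows a contact point adapted to the data, and [y >= 1] keeps the left-hand integrand
    nonnegative. *)
Lemma integral_ln_le (Q : probability T R) (y : T -> R) (c : R) :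
  measurable_fun setT y -> (forall x, 1 <= y x)%R -> (0 < c)%R ->
  \int[Q]_x (ln (y x))%:E <= (c^-1)%:E * \int[Q]_x (y x)%:E + (ln c - 1)%:E.
Proof.
move=> my y1 c0.
have y0 x : (0 < y x)%R by exact: lt_le_trans (y1 x).
have mEy : measurable_fun setT (fun x => (y x)%:E : \bar R) by exact/measurable_EFinP.
have -> : (ln c - 1)%:E = \int[Q]_x (cst (ln c - 1)%R x)%:E.
  have -> : \int[Q]_x (cst (ln c - 1)%R x)%:E = (ln c - 1)%:E * Q setT.
    exact: (integral_cst Q measurableT (ln c - 1)%:E).
  by rewrite [X in _ = _ * X](probability_setT Q) mule1.
rewrite -ge0_integralZl//; last 2 first.
- by move=> x _; rewrite lee_fin ltW.
- by rewrite lee_fin invr_ge0 ltW.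
apply: ae_ge0_le_integral_add.
- by apply/measurable_EFinP; exact: (measurableT_comp (@measurable_ln R)).
- by move=> x; rewrite lee_fin ln_ge0.
- exact: emeasurable_funM.
- by move=> x; rewrite -EFinM lee_fin mulr_ge0 ?invr_ge0// ltW.
- exact: finite_measure_integrable_cst.
- by apply: aeW => x /=; rewrite -EFinM -EFinD lee_fin mulrC ln_le_tangent.
Qed.

End integral_bounds.

Section kl_density.
Local Open Scope ereal_scope.
Local Open Scope charge_scope.
Context disp (T : measurableType disp) (R : realType).
Implicit Types P M : probability T R.

Lemma density_ae_gt0 P M (q : T -> R) :
  measurable_fun setT q -> (forall x, 0 <= q x)%R ->
  (forall A, measurable A -> P A = \int[M]_(x in A) (q x)%:E) ->
  {ae P, forall x, (0 < q x)%R}.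
Proof.
move=> mq q0 PE; exists (q @^-1` [set 0%R]); split.
- by rewrite -[X in measurable X]setTI; exact: mq.
- rewrite PE; last by rewrite -[X in measurable X]setTI; exact: mq.
  by apply: integral0_eq => x /= ->.
- move=> x /= /negP; rewrite -leNgt => qx.
  by apply/eqP; rewrite eq_le qx q0.
Qed.

(** Supplies a real-valued, everywhere nonnegative version of the derivative. It agrees with the one
    in [kl_div] almost everywhere for [M], hence for [P]. At the zeros of [q], where [lne] is [-oo]
    and [ln] is 0, nothing is lost, since [P] gives them no mass. *)
Lemma kl_div_density P M : P `<< M -> exists q : T -> R,
  [/\ measurable_fun setT q, (forall x, 0 <= q x)%R,
      (forall A, measurable A -> P A = \int[M]_(x in A) (q x)%:E) &
      kl_div P M = \int[P]_x (ln (q x))%:E].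
Proof.
move=> PM; pose g := Radon_Nikodym_SigmaFinite.f P M.
have gfin x : g x \is a fin_num by exact: Radon_Nikodym_SigmaFinite.f_fin_num.
have g0 x : 0 <= g x by exact: Radon_Nikodym_SigmaFinite.f_ge0.
have mg : measurable_fun setT g.
  by apply: measurable_int; exact: Radon_Nikodym_SigmaFinite.f_integrable.
pose q x := fine (g x).
have mq : measurable_fun setT q by exact: measurableT_comp.
have q0 x : (0 <= q x)%R by exact: fine_ge0.
have PE A : measurable A -> P A = \int[M]_(x in A) (q x)%:E.
  move=> mA; rewrite (Radon_Nikodym_SigmaFinite.f_integral PM mA).
  by apply: eq_integral => x _; rewrite /q fineK.
exists q; split => //.
rewrite /kl_div asboolT//.
set D := 'd _ '/d _.
have Dfin x : D x \is a fin_num by exact: Radon_Nikodym_fin_num.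
have mD : measurable_fun setT D by apply: measurable_int; exact: Radon_Nikodym_integrable.
have lneE (h : T -> \bar R) : (forall x, h x \is a fin_num) -> measurable_fun setT h ->
    measurable_fun setT (fun x => lne (h x)).
  move=> hfin mh; rewrite (_ : (fun _ => _) = fun x =>
      if (fine (h x) <= 0)%R then -oo else (ln (fine (h x)))%:E); last first.
    by apply/funext => x; rewrite -[in LHS](fineK (hfin x)).
  have mfh : measurable_fun setT (fine \o h) by exact: measurableT_comp.
  apply: measurable_fun_ifT => //.
    exact: measurable_fun_ler.
  by apply/measurable_EFinP; exact: (measurableT_comp (@measurable_ln R)).
apply: ae_eq_integral => //.
- exact: lneE.
- by apply/measurable_EFinP; exact: (measurableT_comp (@measurable_ln R)).
have DqP : ae_eq P setT D (EFin \o q).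
  apply: (null_dominates_ae_eq measurableT PM).
  apply: ae_eq_Radon_Nikodym_density => //.
have qP := density_ae_gt0 mq q0 PE.
apply: filterS2 DqP qP => x Dx qx _.
by rewrite Dx// lne_EFin.
Qed.

(** The negative part is always integrable: it is at most [1 / q], and the integral of [1 / q] under
    [P] is the [M]-mass of the set where [q] is nonzero, hence at most 1. A finite divergence then
    controls the positive part. *)
Lemma integrable_ln_density P M (q : T -> R) :
  measurable_fun setT q -> (forall x, 0 <= q x)%R ->
  (forall A, measurable A -> P A = \int[M]_(x in A) (q x)%:E) ->
  \int[P]_x (ln (q x))%:E < +oo ->
  P.-integrable setT (EFin \o (fun x => ln (q x))).
Proof.
move=> mq q0 PE Koo; pose f := EFin \o (fun x => ln (q x)).
have mf : measurable_fun setT f.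
  by apply/measurable_EFinP; exact: (measurableT_comp (@measurable_ln R)).
have mfn : measurable_fun setT f^\- by exact: measurable_funeneg.
have mfp : measurable_fun setT f^\+ by exact: measurable_funepos.
have mqV : measurable_fun setT (fun x => (q x)^-1)%R.
  rewrite (_ : (fun _ => _) = (@powR R ^~ (-1)) \o q)%R.
    exact: (measurableT_comp (measurable_powR (-1))).
  by apply/funext => x /=; rewrite powR_inv1.
have neg : \int[P]_x f^\- x < +oo.
  apply: (@le_lt_trans _ _ (\int[P]_x ((q x)^-1)%:E)).
    apply: ge0_le_integral => //.
    - exact/measurable_EFinP.
    move=> x _; rewrite funenegE /f /= -EFin_max lee_fin.
    have := q0 x; rewrite le_eqVlt => /predU1P[<-|qx].
      by rewrite ln0// oppr0 maxxx invr0.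
    rewrite ge_max invr_ge0 q0 andbT -lnV ?posrE//.
    have := @ln_le_tangent R (q x)^-1 1; rewrite divr1 ln1 invr_gt0 qx => /(_ isT ltr01).
    by lra.
  rewrite (@ge0_integral_density _ _ _ M P q)//.
  - apply: (@le_lt_trans _ _ (\int[M]_x (cst 1 x))).
      apply: ge0_le_integral => //.
      + by move=> x _; rewrite -EFinM lee_fin mulr_ge0// invr_ge0.
      + by apply: emeasurable_funM; exact/measurable_EFinP.
      + move=> x _; rewrite /= -EFinM lee_fin; have [->|qx] := eqVneq (q x) 0%R.
          by rewrite mulr0.
        by rewrite mulVf.
    rewrite integral_cst// mul1e.
    exact: (le_lt_trans (probability_le1 M measurableT) (ltry 1)).
  - exact/measurable_EFinP.
  - by move=> x; rewrite lee_fin invr_ge0.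
apply/integrableP; split => //.
rewrite -/f; under eq_integral => x _ do
  rewrite -[X in `|X|]/(f x) -[`|f x|]/((abse \o f) x) fune_abse.
rewrite ge0_integralD//= lte_add_pinfty//.
move: Koo; rewrite integralE -/f.
case: (\int[P]_x f^\+ x) (\int[P]_x f^\- x) neg => [a| |] [b| |] //=; by rewrite ?ltry.
Qed.

End kl_density.

Section affinity.
Local Open Scope ereal_scope.
Context disp (T : measurableType disp) (R : realType).
Variables (alpha : R) (M P : probability T R) (r q : T -> R).
Hypotheses (alpha_gt0 : (0 < alpha)%R) (alpha_lt1 : (alpha < 1)%R).
Hypotheses (mr : measurable_fun setT r) (mq : measurable_fun setT q).
Hypotheses (r_gt0 : forall x, (0 < r x)%R) (q_ge0 : forall x, (0 <= q x)%R).
Hypothesis r_int : \int[M]_x (r x)%:E = 1.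
Hypothesis PE : forall A, measurable A -> P A = \int[M]_(x in A) (q x)%:E.

Definition affinity : \bar R := \int[M]_x (r x `^ alpha * q x `^ (1 - alpha))%:E.

Let mf : measurable_fun setT (fun x => (r x `^ alpha * q x `^ (1 - alpha))%:E : \bar R).
Proof.
by apply/measurable_EFinP; apply: measurable_funM;
  exact: (measurableT_comp (measurable_powR _)).
Qed.

Let f0 x : (0 <= r x `^ alpha * q x `^ (1 - alpha))%R.
Proof. by rewrite mulr_ge0 ?powR_ge0. Qed.

(** Young's inequality with conjugate exponents [1 / alpha] and [1 / (1 - alpha)] bounds the
    integrand by [alpha * r + (1 - alpha) * q], a mixture of two probability densities. *)
Lemma affinity_le1 : affinity <= 1.
Proof.
have q_int : \int[M]_x (q x)%:E = 1 by rewrite -PE//; exact: (probability_setT P).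
have a1 : (0 < 1 - alpha)%R by rewrite subr_gt0.
apply: (@le_trans _ _ (\int[M]_x (alpha%:E * (r x)%:E + (1 - alpha)%:E * (q x)%:E))).
  apply: ge0_le_integral => //.
  - by move=> x _; rewrite lee_fin.
  - by apply: emeasurable_funD; apply: emeasurable_funM => //; exact/measurable_EFinP.
  move=> x _; rewrite -!EFinM -EFinD lee_fin.
  have := @conjugate_powR R (r x `^ alpha)%R (q x `^ (1 - alpha))%R alpha^-1%R (1 - alpha)^-1%R
    (powR_ge0 _ _) (powR_ge0 _ _).
  rewrite !invr_gt0 !invrK subrKC => /(_ alpha_gt0 a1 erefl).
  by rewrite -!powRrM !mulfV ?gt_eqF// (powRr1 (ltW (r_gt0 x))) (powRr1 (q_ge0 x)); lra.
rewrite ge0_integralD//; last 4 first.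
- by move=> x _; rewrite -EFinM lee_fin mulr_ge0// ltW.
- by apply: emeasurable_funM => //; exact/measurable_EFinP.
- by move=> x _; rewrite -EFinM lee_fin mulr_ge0// ltW.
- by apply: emeasurable_funM => //; exact/measurable_EFinP.
rewrite !ge0_integralZl//; last 6 first.
- exact/measurable_EFinP.
- by move=> x _; rewrite lee_fin.
- by rewrite lee_fin ltW.
- exact/measurable_EFinP.
- by move=> x _; rewrite lee_fin ltW.
- by rewrite lee_fin ltW.
by rewrite r_int q_int !mule1 -EFinD subrKC.
Qed.

(** As [r] is positive, a vanishing affinity would force [q] to vanish almost everywhere, against
    the unit mass of [P]. *)
Lemma affinity_gt0 : 0 < affinity.
Proof.
rewrite lt_neqAle eq_sym integral_ge0 ?andbT; last by move=> x _; rewrite lee_fin.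
apply/eqP => aff0.
have : ae_eq M setT (fun x => (r x `^ alpha * q x `^ (1 - alpha))%:E : \bar R) (cst 0).
  apply/ae_eq_integral_abs => //.
  by rewrite -[RHS]aff0; apply: eq_integral => x _; rewrite gee0_abs// lee_fin.
move=> H; have : P setT = 0.
  rewrite PE// -[RHS](integral0 M setT); apply: ae_eq_integral => //.
  - exact/measurable_EFinP.
  apply: filterS H => x /(_ I) /= [/eqP]; rewrite mulf_eq0 => /orP[] + _.
    by rewrite powR_eq0 gt_eqF.
  by rewrite powR_eq0 => /andP[/eqP -> _].
by move/eqP; rewrite [P setT](probability_setT P) onee_eq0.
Qed.

Lemma affinity_fin_num : affinity \is a fin_num.
Proof. by rewrite ge0_fin_numE ?(ltW affinity_gt0)// (le_lt_trans affinity_le1)// ltry. Qed.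

(** Under [P] the integrand acquires the factor [q], and [(r / q) ^ alpha] times [q] is the
    integrand of the affinity. Where [q] vanishes both sides are 0, since [1 - alpha] is nonzero. *)
Lemma integral_tilted_ratio : \int[P]_x ((r x / q x) `^ alpha)%R%:E = affinity.
Proof.
rewrite (@ge0_integral_density _ _ _ M P q)//.
- apply: eq_integral => x _; rewrite -EFinM; congr EFin.
  have [->|qx] := eqVneq (q x) 0%R.
    by rewrite mulr0 powR0 ?mulr0// subr_eq0 gt_eqF.
  have qx0 : (0 < q x)%R by rewrite lt_neqAle eq_sym qx q_ge0.
  rewrite powRM ?invr_ge0 ?(ltW (r_gt0 x))// -mulrA; congr (_ * _)%R.
  rewrite -powR_inv1 ?ltW// -powRrM mulN1r.
  by rewrite -{2}(powRr1 (ltW qx0)) -powRD ?qx ?implybT// addrC.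
- apply/measurable_EFinP; apply: (measurableT_comp (measurable_powR _)).
  rewrite (_ : (fun _ => _) = fun x => r x * q x `^ (-1))%R.
    by apply: measurable_funM => //; exact: (measurableT_comp (measurable_powR _)).
  by apply/funext => x; rewrite powR_inv1.
- by move=> x; rewrite lee_fin powR_ge0.
Qed.

End affinity.

(** * Fractional posteriors *)

Section fractional_posterior.
Local Open Scope ereal_scope.
Context dTh (Th : measurableType dTh) disp (T : measurableType disp) (R : realType).
Variables (pi : probability Th R) (M P0 : probability T R).
Variables (p : Th -> T -> R) (ps q : T -> R) (alpha : R) (n : nat).
Hypotheses (alpha_gt0 : (0 < alpha)%R) (alpha_lt1 : (alpha < 1)%R).
Hypothesis mp : measurable_fun setT (fun u : Th * T => p u.1 u.2).
Hypotheses (p_gt0 : forall th z, (0 < p th z)%R) (p_le1 : forall th z, (p th z <= 1)%R).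
Hypotheses (mps : measurable_fun setT ps) (ps_gt0 : forall z, (0 < ps z)%R).
Hypotheses (mq : measurable_fun setT q) (q_ge0 : forall z, (0 <= q z)%R).
Hypothesis P0E : forall A, measurable A -> P0 A = \int[M]_(z in A) (q z)%:E.
Hypothesis ratio_int : forall th, \int[M]_z (p th z / ps z)%:E = 1.

(** [p] and [ps] are conditional densities of the label; the design law stays inside [M] and cancels
    in the ratio, which is what has to integrate to 1. *)
Definition model_ratio th z : R := (p th z / ps z)%R.

Definition model_affinity th : R := fine (affinity alpha M (model_ratio th) q).

Definition power_likelihood (z : 'I_n -> T) th : R := ((\prod_i p th (z i)) `^ alpha)%R.

Let measurable_inv d' (S : measurableType d') (f : S -> R) :
  measurable_fun setT f -> (forall x, 0 <= f x)%R ->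
  measurable_fun setT (fun x => (f x)^-1)%R.
Proof.
move=> mf f0; rewrite (_ : (fun _ => _) = (@powR R ^~ (-1)) \o f)%R.
  exact: (measurableT_comp (measurable_powR (-1))).
by apply/funext => x /=; rewrite powR_inv1.
Qed.

Let measurable_p d' (S : measurableType d') (f : S -> Th) (g : S -> T) :
  measurable_fun setT f -> measurable_fun setT g ->
  measurable_fun setT (fun x => p (f x) (g x)).
Proof.
move=> mf mg; have mfg : measurable_fun setT (fun x => (f x, g x)).
  exact: measurable_fun_pair.
exact: (measurableT_comp mp mfg).
Qed.

Lemma model_ratio_gt0 th z : (0 < model_ratio th z)%R.
Proof. exact: divr_gt0. Qed.

Lemma measurable_model_ratio d' (S : measurableType d') (f : S -> Th) (g : S -> T) :
  measurable_fun setT f -> measurable_fun setT g ->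
  measurable_fun setT (fun x => model_ratio (f x) (g x)).
Proof.
move=> mf mg; apply: measurable_funM; first exact: measurable_p.
apply: (measurable_inv (f := fun x => ps (g x))) => [|x]; last exact: ltW.
exact: (measurableT_comp mps mg).
Qed.

Let mratio th : measurable_fun setT (model_ratio th).
Proof. by apply: (measurable_model_ratio (f := cst th) (g := id)). Qed.

Lemma model_affinity_bounds th : (0 < model_affinity th <= 1)%R.
Proof.
have := affinity_gt0 alpha (mratio th) mq (model_ratio_gt0 th) P0E.
have := affinity_le1 alpha_gt0 alpha_lt1 (mratio th) mq (model_ratio_gt0 th) q_ge0
  (ratio_int th) P0E.
have := affinity_fin_num alpha_gt0 alpha_lt1 (mratio th) mq (model_ratio_gt0 th) q_ge0
  (ratio_int th) P0E.
by move=> /fineK <-; rewrite lte_fin lee_fin => -> ->.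
Qed.

Lemma model_affinityE th :
  (model_affinity th)%:E = affinity alpha M (model_ratio th) q.
Proof.
by rewrite fineK// (affinity_fin_num alpha_gt0 alpha_lt1 (mratio th) mq
  (model_ratio_gt0 th) q_ge0 (ratio_int th) P0E).
Qed.

Lemma measurable_model_affinity : measurable_fun setT model_affinity.
Proof.
apply: measurableT_comp => //.
apply: (measurable_fun_fubini_tonelli_F (m2 := M) (fun u : Th * T =>
  (model_ratio u.1 u.2 `^ alpha * q u.2 `^ (1 - alpha))%:E)).
  apply/measurable_EFinP; apply: measurable_funM.
    apply: (measurableT_comp (measurable_powR _)).
    by apply: measurable_model_ratio; [exact: measurable_fst|exact: measurable_snd].
  apply: (measurableT_comp (measurable_powR _)).
  exact: (measurableT_comp mq measurable_snd).
by move=> u; rewrite lee_fin mulr_ge0 ?powR_ge0.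
Qed.

Lemma measurable_power_likelihood_joint d' (S : measurableType d')
    (f : S -> Th) (g : S -> 'I_n -> T) :
  measurable_fun setT f -> (forall i, measurable_fun setT (g ^~ i)) ->
  measurable_fun setT (fun x => power_likelihood (g x) (f x)).
Proof.
move=> mf mg; apply: (measurableT_comp (measurable_powR _)).
by apply: measurable_prod => i _; exact: measurable_p.
Qed.

Lemma measurable_power_likelihood z : measurable_fun setT (power_likelihood z).
Proof. by apply: (measurable_power_likelihood_joint (f := id) (g := fun=> z)). Qed.

Lemma power_likelihood_gt0 z th : (0 < power_likelihood z th)%R.
Proof. by rewrite powR_gt0//; exact: prodr_gt0. Qed.

Lemma power_likelihood_ge0 z th : (0 <= power_likelihood z th)%R.
Proof. exact/ltW/power_likelihood_gt0. Qed.

Definition evidence z : \bar R := \int[pi]_th (power_likelihood z th)%:E.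

Definition posterior z : probability Th R :=
  mnormalize (mdensity pi (measurable_power_likelihood z) (power_likelihood_ge0 z)) pi.

Lemma evidence_le1 z : evidence z <= 1.
Proof.
apply: (@le_trans _ _ (\int[pi]_th (cst 1 th))).
  apply: ge0_le_integral => //.
  - by move=> th _; rewrite lee_fin power_likelihood_ge0.
  - by apply/measurable_EFinP; exact: measurable_power_likelihood.
  move=> th _; rewrite lee_fin /power_likelihood.
  apply: (@le_trans _ _ (1 `^ alpha)%R); last by rewrite powR1.
  apply: ge0_ler_powR; rewrite ?nnegrE ?(ltW alpha_gt0)//.
    by apply: prodr_ge0 => i _; exact: ltW.
  by apply: prodr_ile1 => i; rewrite (ltW (p_gt0 _ _)) p_le1.
by rewrite integral_cst// mul1e; exact: (probability_le1 pi measurableT).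
Qed.

Lemma evidence_gt0 z : 0 < evidence z.
Proof.
rewrite lt_neqAle eq_sym integral_ge0 ?andbT; last first.
  by move=> th _; rewrite lee_fin power_likelihood_ge0.
apply/eqP => ev0.
have mL : measurable_fun setT (fun th => (power_likelihood z th)%:E : \bar R).
  by apply/measurable_EFinP; exact: measurable_power_likelihood.
have : ae_eq pi setT (fun th => (power_likelihood z th)%:E : \bar R) (cst 0).
  apply/ae_eq_integral_abs => //.
  rewrite -[RHS]ev0; apply: eq_integral => th _.
  by rewrite gee0_abs// lee_fin power_likelihood_ge0.
move=> [N [mN N0 subN]].
have : pi setT <= pi N.
  apply: le_measure; rewrite ?inE// => th _; apply: subN => /= /(_ I) [] /eqP.
  by rewrite gt_eqF// power_likelihood_gt0.
by rewrite N0 [X in X <= _](probability_setT pi) lee_fin ler10.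
Qed.

Lemma evidence_fin_num z : evidence z \is a fin_num.
Proof.
by rewrite ge0_fin_numE ?(ltW (evidence_gt0 z))// (le_lt_trans (evidence_le1 z))// ltry.
Qed.

Lemma ge0_integral_posterior z (g : Th -> R) :
  measurable_fun setT g -> (forall th, 0 <= g th)%R ->
  \int[posterior z]_th (g th)%:E =
  (fine (evidence z))^-1%:E * \int[pi]_th (g th * power_likelihood z th)%:E.
Proof.
move=> mg g0; have mEg : measurable_fun setT (fun th => (g th)%:E : \bar R).
  exact/measurable_EFinP.
pose mu := mdensity pi (measurable_power_likelihood z) (power_likelihood_ge0 z).
rewrite (@ge0_integral_mnormalize _ _ _ mu)//; last 2 first.
- by rewrite gt_eqF//; exact: evidence_gt0.
- by have := evidence_fin_num z; rewrite fin_numE => /andP[].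
transitivity ((fine (evidence z))^-1%:E * \int[mu]_x (g x)%:E) => //.
congr (_ * _).
rewrite (@ge0_integral_density _ _ _ pi mu (power_likelihood z))//.
- exact: measurable_power_likelihood.
- exact: power_likelihood_ge0.
Qed.

Lemma powR_prod (I : finType) (f : I -> R) (a : R) : (forall i, 0 <= f i)%R ->
  ((\prod_i f i) `^ a = \prod_i f i `^ a)%R.
Proof.
move=> f0.
suff [] : (0 <= \prod_i f i)%R /\ ((\prod_i f i) `^ a = \prod_i f i `^ a)%R by [].
apply: (big_ind2 (fun x y => 0 <= x /\ x `^ a = y)%R).
- by rewrite ler01 powR1.
- by move=> x u y v [x0 <-] [y0 <-]; rewrite mulr_ge0// powRM.
- by [].
Qed.

Lemma ln_prod (I : finType) (f : I -> R) : (forall i, 0 < f i)%R ->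
  ln (\prod_i f i)%R = (\sum_i ln (f i))%R.
Proof.
move=> f0; suff [] : (0 < \prod_i f i)%R /\ ln (\prod_i f i)%R = (\sum_i ln (f i))%R by [].
apply: (big_ind2 (fun a b => (0 < a)%R /\ ln a = b)).
- by rewrite ltr01 ln1.
- by move=> a b c e [a0 <-] [c0 <-]; rewrite mulr_gt0// lnM.
- by [].
Qed.

Definition inverse_affinity_power th : R := (model_affinity th ^- n)%R.

Lemma inverse_affinity_power_ge1 th : (1 <= inverse_affinity_power th)%R.
Proof.
have /andP[a0 a1] := model_affinity_bounds th.
by rewrite invf_ge1 ?exprn_gt0// exprn_ile1// ltW.
Qed.

Lemma measurable_inverse_affinity_power : measurable_fun setT inverse_affinity_power.
Proof.
apply: (measurable_inv (f := fun th => model_affinity th ^+ n)%R) => [|th].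
  exact/measurable_funX/measurable_model_affinity.
by rewrite exprn_ge0//; have /andP[/ltW] := model_affinity_bounds th.
Qed.

Definition tilted_product (z : 'I_n -> T) th : R :=
  (inverse_affinity_power th * \prod_i (model_ratio th (z i) / q (z i)) `^ alpha)%R.

Lemma tilted_product_ge0 z th : (0 <= tilted_product z th)%R.
Proof.
rewrite mulr_ge0//; last by apply: prodr_ge0 => i _; exact: powR_ge0.
exact: le_trans ler01 (inverse_affinity_power_ge1 th).
Qed.

Lemma measurable_tilted_product_joint d' (S : measurableType d')
    (f : S -> Th) (g : S -> 'I_n -> T) :
  measurable_fun setT f -> (forall i, measurable_fun setT (g ^~ i)) ->
  measurable_fun setT (fun x => tilted_product (g x) (f x)).
Proof.
move=> mf mg; apply: measurable_funM.
  exact: (measurableT_comp measurable_inverse_affinity_power).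
apply: measurable_prod => i _; apply: (measurableT_comp (measurable_powR _)).
apply: measurable_funM; first exact: measurable_model_ratio.
apply: (measurable_inv (f := fun x => q (g x i))) => [|x]; last by [].
exact: (measurableT_comp mq).
Qed.

(* The tangent line of ln is taken at [Qz / evidence z], where [Qz] is the power
   of the likelihood of the true law: the evidence then cancels in the first
   term, whose expectation can be computed exactly. *)
Lemma integral_posterior_ln_le z (b : R) :
  (forall i, 0 < q (z i))%R -> (0 < b)%R ->
  (b * \prod_i (ps (z i)) `^ alpha)%:E <= evidence z ->
  \int[posterior z]_th (ln (inverse_affinity_power th))%:E <=
  \int[pi]_th (tilted_product z th)%:E +
    (alpha * (\sum_i ln (q (z i))) - ln b - 1)%:E.
Proof.
move=> qz b0 bev.
have evK := fineK (evidence_fin_num z).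
set Zr := fine (evidence z) in evK.
have Zr0 : (0 < Zr)%R by rewrite -lte_fin evK evidence_gt0.
pose Qz : R := (\prod_i (q (z i) * ps (z i)) `^ alpha)%R.
have Qz0 : (0 < Qz)%R by apply: prodr_gt0 => i _; rewrite powR_gt0// mulr_gt0.
have c0 : (0 < Qz / Zr)%R by exact: divr_gt0.
have my := measurable_inverse_affinity_power.
have y1 := inverse_affinity_power_ge1.
have y0 th : (0 <= inverse_affinity_power th)%R by exact: le_trans ler01 (y1 th).
apply: (le_trans (integral_ln_le (posterior z) my y1 c0)).
rewrite ge0_integral_posterior// muleA -/Zr -EFinM.
have -> : ((Qz / Zr)^-1 / Zr = Qz^-1)%R.
  by rewrite invf_div mulrAC divff ?mul1r// gt_eqF.
have -> : Qz^-1%:E * \int[pi]_th (inverse_affinity_power th * power_likelihood z th)%:E =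
    \int[pi]_th (tilted_product z th)%:E.
  rewrite -ge0_integralZl//; last 3 first.
  - apply/measurable_EFinP; apply: measurable_funM => //.
    exact: measurable_power_likelihood.
  - by move=> th _; rewrite lee_fin mulr_ge0// power_likelihood_ge0.
  - by rewrite lee_fin invr_ge0 ltW.
  apply: eq_integral => th _; rewrite -EFinM; congr EFin.
  rewrite /tilted_product mulrCA; congr (_ * _)%R.
  apply: (mulfI (x := Qz)); first by rewrite gt_eqF.
  rewrite mulrA divff ?gt_eqF// mul1r /Qz -big_split/= /power_likelihood.
  rewrite powR_prod; last by move=> i; exact: ltW.
  apply: eq_bigr => i _.
  have qp0 : (0 <= q (z i) * ps (z i))%R by apply: mulr_ge0; exact: ltW.
  have rq0 : (0 <= model_ratio th (z i) / q (z i))%R.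
    by apply: divr_ge0 => //; exact/ltW/model_ratio_gt0.
  rewrite -powRM//.
  congr (_ `^ _)%R; rewrite /model_ratio; field.
  by rewrite !gt_eqF.
(* There remains [ln (Qz / Zr) <= alpha * sum ln q - ln b]. The assumed lower bound on the evidence
   contains the same powers of [ps] as [Qz], so only the powers of [q] and [b] survive. *)
apply: leeD2l; rewrite lee_fin lerD2r.
have lnq : ln (\prod_i q (z i) `^ alpha)%R = (alpha * \sum_i ln (q (z i)))%R.
  rewrite ln_prod ?mulr_sumr; last by move=> i; exact: powR_gt0.
  by apply: eq_bigr => i _; rewrite ln_powR.
rewrite -lnq -ln_div ?posrE//; last by apply: prodr_gt0 => i _; exact: powR_gt0.
rewrite ler_ln ?posrE ?divr_gt0//; last by apply: prodr_gt0 => i _; exact: powR_gt0.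
rewrite ler_pdivrMr// mulrAC ler_pdivlMr//.
move: bev; rewrite -evK lee_fin => bev.
rewrite /Qz (eq_bigr (fun i => q (z i) `^ alpha * ps (z i) `^ alpha)%R); last first.
  by move=> i _; rewrite powRM// ltW.
rewrite big_split/= -mulrA ler_wpM2l//; last by rewrite mulrC.
by apply: prodr_ge0 => i _; exact: powR_ge0.
Qed.

(** * Expectation over the sample *)

Section expectation.
Context dO (Omega : measurableType dO) (P : probability Omega R).
Variable Z : 'I_n -> {mfun Omega >-> T}.
Hypothesis Z_indep : mutually_independent P Z.
Hypothesis Z_law : forall i, has_law P (Z i) P0.

Let mZ i : measurable_fun setT (Z i). Proof. by []. Qed.

Lemma ge0_integral_law i (f : T -> \bar R) :
  measurable_fun setT f -> (forall x, 0 <= f x) ->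
  \int[P]_w f (Z i w) = \int[P0]_x f x.
Proof.
move=> mf f0.
pose mu := measure_function_pushforward__canonical__measure_function_Measure P (mZ i).
transitivity (\int[mu]_x f x); first by rewrite ge0_integral_pushforward.
by apply: eq_measure_integral => A mA _; exact: Z_law.
Qed.

Lemma measurable_integral_tilted :
  measurable_fun setT (fun w => \int[pi]_th (tilted_product (Z^~ w) th)%:E).
Proof.
apply: (measurable_fun_fubini_tonelli_F (m2 := pi)
  (fun u : Omega * Th => (tilted_product (Z^~ u.1) u.2)%:E)).
  apply/measurable_EFinP; apply: (measurable_tilted_product_joint (f := snd)
    (g := fun u i => Z i u.1)) => [|i]; first exact: measurable_snd.
  exact: (measurableT_comp (mZ i) measurable_fst).
by move=> u; rewrite lee_fin tilted_product_ge0.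
Qed.

Lemma expectation_tilted :
  \int[P]_w \int[pi]_th (tilted_product (Z^~ w) th)%:E = 1.
Proof.
rewrite (fubini_tonelli (m1 := P) (m2 := pi)
  (fun u : Omega * Th => (tilted_product (Z^~ u.1) u.2)%:E))/=; last 2 first.
- apply/measurable_EFinP; apply: (measurable_tilted_product_joint (f := snd)
    (g := fun u i => Z i u.1)) => [|i]; first exact: measurable_snd.
  exact: (measurableT_comp (mZ i) measurable_fst).
- by move=> u; rewrite lee_fin tilted_product_ge0.
transitivity (\int[pi]_th cst 1 th); last first.
  by rewrite integral_cst// mul1e; exact: (probability_setT pi).
apply: eq_integral => th _.
pose h (i : 'I_n) x : R := ((model_ratio th x / q x) `^ alpha)%R.
have h0 i x : (0 <= h i x)%R by exact: powR_ge0.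
have mh i : measurable_fun setT (h i).
  apply: (measurableT_comp (measurable_powR _)); apply: measurable_funM => //.
  exact: measurable_inv.
have /andP[a0 a1] := model_affinity_bounds th.
have hE i : \int[P]_w (h i (Z i w))%:E = (model_affinity th)%:E.
  rewrite (@ge0_integral_law i (fun x => (h i x)%:E)).
  - rewrite (integral_tilted_ratio alpha_lt1 (mratio th) mq
      (model_ratio_gt0 th) q_ge0 P0E).
    by rewrite model_affinityE.
  - exact/measurable_EFinP.
  - by move=> x; rewrite lee_fin.
rewrite /tilted_product; under eq_integral do rewrite EFinM.
rewrite ge0_integralZl//; last 3 first.
- apply/measurable_EFinP; apply: measurable_prod => i _.
  exact: (measurableT_comp (mh i) (mZ i)).
- by move=> w _; rewrite lee_fin; apply: prodr_ge0 => i _; exact: h0.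
- by rewrite lee_fin (le_trans ler01)// inverse_affinity_power_ge1.
rewrite (ge0_expectation_prod Z_indep mh h0); last by move=> i; rewrite hE ltry.
rewrite (eq_bigr (fun=> (model_affinity th)%:E)); last by move=> i _; exact: hE.
rewrite prodEFin prodr_const card_ord -EFinM /inverse_affinity_power mulVf//.
by rewrite gt_eqF// exprn_gt0.
Qed.

(** The measure of integration itself depends on [w]. Bayes' formula rewrites the integral as a
    quotient of two integrals against the fixed prior, each measurable in [w] by Tonelli. *)
Lemma measurable_integral_posterior (g : Th -> R) :
  measurable_fun setT g -> (forall th, 0 <= g th)%R ->
  measurable_fun setT (fun w => \int[posterior (Z^~ w)]_th (g th)%:E).
Proof.
move=> mg g0; under eq_fun do rewrite ge0_integral_posterior//.
have mL : measurable_fun setT (fun u : Omega * Th => power_likelihood (Z^~ u.1) u.2).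
  apply: (measurable_power_likelihood_joint (f := snd) (g := fun u i => Z i u.1)).
    exact: measurable_snd.
  by move=> i; exact: (measurableT_comp (mZ i) measurable_fst).
apply: emeasurable_funM.
  apply/measurable_EFinP; apply: (measurable_inv (f := fun w => fine (evidence (Z^~ w)))).
    apply: measurableT_comp => //.
    apply: (measurable_fun_fubini_tonelli_F (m2 := pi)
      (fun u : Omega * Th => (power_likelihood (Z^~ u.1) u.2)%:E)).
      exact/measurable_EFinP.
    by move=> u; rewrite lee_fin power_likelihood_ge0.
  by move=> w; rewrite fine_ge0// ltW// evidence_gt0.
apply: (measurable_fun_fubini_tonelli_F (m2 := pi)
  (fun u : Omega * Th => (g u.2 * power_likelihood (Z^~ u.1) u.2)%:E)).
  apply/measurable_EFinP; apply: measurable_funM => //.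
  exact: (measurableT_comp mg measurable_snd).
by move=> u; rewrite lee_fin mulr_ge0// power_likelihood_ge0.
Qed.

Lemma integral_law i (f : T -> R) : P0.-integrable setT (EFin \o f) ->
  P.-integrable setT (fun w => (f (Z i w))%:E) /\
  \int[P]_w (f (Z i w))%:E = \int[P0]_x (f x)%:E.
Proof.
move=> fi; have mf := measurable_int _ fi.
have mfp : measurable_fun setT (EFin \o f)^\+ by exact: measurable_funepos.
have mfn : measurable_fun setT (EFin \o f)^\- by exact: measurable_funeneg.
split.
  apply/integrableP; split; first exact: (measurableT_comp mf (mZ i)).
  rewrite (@ge0_integral_law i (fun x => `|(f x)%:E|))//.
    by have /integrableP[] := fi.
  exact: measurableT_comp.
rewrite integralE [RHS]integralE; congr (_ - _).
  rewrite -(@ge0_integral_law i _ mfp)//.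
  by apply: eq_integral => w _; rewrite !funeposE.
rewrite -(@ge0_integral_law i _ mfn)//.
by apply: eq_integral => w _; rewrite !funenegE.
Qed.

Lemma expectation_posterior_ln_le (b : T -> R) (kappa : R) :
  P0.-integrable setT (EFin \o (fun x => ln (q x))) ->
  P0.-integrable setT (EFin \o b) ->
  (forall z : 'I_n -> T,
    (expR (- (\sum_i b (z i) + kappa)) * \prod_i (ps (z i)) `^ alpha)%:E <= evidence z) ->
  \int[P]_w \int[posterior (Z^~ w)]_th (ln (inverse_affinity_power th))%:E <=
  (n%:R * (alpha * fine (\int[P0]_x (ln (q x))%:E) + fine (\int[P0]_x (b x)%:E)) +
    kappa)%:E.
Proof.
move=> iq ib bev.
pose l x := (alpha * ln (q x) + b x)%R.
have il : P0.-integrable setT (EFin \o l).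
  have -> : EFin \o l = (fun x => alpha%:E * (ln (q x))%:E) \+ (EFin \o b).
    by apply/funext => x; rewrite /= EFinD EFinM.
  by apply: integrableD => //; exact: integrableZl.
have lE : \int[P0]_x (l x)%:E = (alpha * fine (\int[P0]_x (ln (q x))%:E) +
    fine (\int[P0]_x (b x)%:E))%:E.
  under eq_integral do rewrite EFinD EFinM.
  rewrite integralD//; last exact: integrableZl.
  rewrite integralZl// EFinD EFinM !fineK//; exact: integrable_fin_num.
(* The -1 is the constant of the tangent line; it cancels the expectation 1 of the tilted product at
   the end. *)
pose B w : R := (\sum_i l (Z i w) + (kappa - 1))%R.
have iB : P.-integrable setT (EFin \o B).
  have -> : EFin \o B = (fun w => \sum_i (l (Z i w))%:E) \+ cst (kappa - 1)%:E.
    by apply/funext => w; rewrite /= EFinD sumEFin.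
  apply: integrableD => //; last exact: finite_measure_integrable_cst.
  by apply: integrable_sum => // i _; exact: (@integral_law i _ il).1.
have BE : \int[P]_w (B w)%:E =
    (n%:R * (alpha * fine (\int[P0]_x (ln (q x))%:E) + fine (\int[P0]_x (b x)%:E)) +
    (kappa - 1))%:E.
  under eq_integral do rewrite EFinD -sumEFin.
  rewrite integralD//; last 2 first.
  - by apply: integrable_sum => // i _; exact: (@integral_law i _ il).1.
  - exact: finite_measure_integrable_cst.
  rewrite integral_sum//; last by move=> i; exact: (@integral_law i _ il).1.
  rewrite (eq_bigr (fun=> \int[P0]_x (l x)%:E)); last first.
    by move=> i _; exact: (@integral_law i _ il).2.
  rewrite lE sumEFin sumr_const card_ord -[in LHS]mulr_natl.
  rewrite (integral_cst P measurableT (kappa - 1)%:E).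
  by rewrite [X in _ + _ * X](probability_setT P) mule1 -EFinD.
apply: (@le_trans _ _ (\int[P]_w \int[pi]_th (tilted_product (Z^~ w) th)%:E +
    \int[P]_w (B w)%:E)); last first.
  by rewrite expectation_tilted BE -EFinD lee_fin; lra.
apply: ae_ge0_le_integral_add => //.
- apply: measurable_integral_posterior.
    exact: (measurableT_comp (@measurable_ln R) measurable_inverse_affinity_power).
  by move=> th; rewrite ln_ge0// inverse_affinity_power_ge1.
- move=> w; apply: integral_ge0 => th _.
  by rewrite lee_fin ln_ge0// inverse_affinity_power_ge1.
- exact: measurable_integral_tilted.
- by move=> w; apply: integral_ge0 => th _; rewrite lee_fin tilted_product_ge0.
have qP i : {ae P, forall w, (0 < q (Z i w))%R}.
  have [N [mN N0 subN]] := density_ae_gt0 mq q_ge0 P0E.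
  exists (Z i @^-1` N); split.
  - by rewrite -[X in measurable X]setTI; exact: mZ.
  - by rewrite Z_law.
  - by move=> w /= qi; exact: subN.
(* The finitely many null sets are merged through the countable version, indices from [n] on being
   vacuous. *)
have qP' : {ae P, forall w, forall k (kn : (k < n)%N), (0 < q (Z (Ordinal kn) w))%R}.
  apply: ae_foralln => k; case: (pselect (k < n)%N) => [kn|nk].
    by apply: filterS (qP (Ordinal kn)) => w qw kn'; rewrite (bool_irrelevance kn' kn).
  by apply: aeW => w kn; case: nk.
apply: filterS qP' => w qw'.
have qw i : (0 < q (Z i w))%R by case: i => k kn; exact: qw'.
have := integral_posterior_ln_le qw (expR_gt0 _) (bev (Z^~ w)).
move=> /le_trans; apply; apply: leeD2l; rewrite lee_fin expRK /B /l.
by rewrite big_split/= -mulr_sumr; lra.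
Qed.

End expectation.
End fractional_posterior.

(** * Logistic regression *)

Section logistic_lipschitz.
Context (R : realType) (d : nat).
Implicit Types (x th a : vec R d).

Lemma norm2_ge0 x : 0 <= norm2 x.
Proof. exact: sqrtr_ge0. Qed.

Lemma measurable_norm2 : measurable_fun setT (@norm2 R d).
Proof.
rewrite (_ : @norm2 R d = (fun x => (\sum_i coord x i ^+ 2) `^ 2^-1)); last first.
  by apply/funext => x; rewrite powR12_sqrt// sumr_ge0// => i _; exact: sqr_ge0.
apply: (measurableT_comp (measurable_powR _)); apply: measurable_sum => i.
by apply: measurable_funX; exact: measurable_coord.
Qed.

(** Everything follows from the identity between [B * (A * B - c ^+ 2)] and the sum of the squares
    of [B * u i - c * v i]; when [B] is 0, all [v i] vanish. *)
Lemma cauchy_schwarz_sum (u v : 'I_d -> R) :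
  `|\sum_i u i * v i| <= Num.sqrt (\sum_i u i ^+ 2) * Num.sqrt (\sum_i v i ^+ 2).
Proof.
set A := \sum_i u i ^+ 2; set B := \sum_i v i ^+ 2; set c := \sum_i u i * v i.
have A0 : 0 <= A by apply: sumr_ge0 => i _; exact: sqr_ge0.
have B0 : 0 <= B by apply: sumr_ge0 => i _; exact: sqr_ge0.
rewrite -sqrtrM// -sqrtr_sqr ler_wsqrtr//.
have H : 0 <= B * (A * B - c ^+ 2).
  have -> : B * (A * B - c ^+ 2) = \sum_i (B * u i - c * v i) ^+ 2.
    transitivity (\sum_i (B ^+ 2 * u i ^+ 2 + (- (2 * B * c)) * (u i * v i) +
        c ^+ 2 * v i ^+ 2)).
      by rewrite !big_split/= -!mulr_sumr -/A -/B -/c; ring.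
    by apply: eq_bigr => i _; ring.
  by apply: sumr_ge0 => i _; exact: sqr_ge0.
have [Bp|] := ltP 0 B; first by move: H; rewrite pmulr_rge0// subr_ge0.
move=> Bn; have BE : B = 0 by apply/eqP; rewrite eq_le Bn B0.
have v0 i : v i = 0.
  move/eqP: BE; rewrite psumr_eq0; last by move=> j _; exact: sqr_ge0.
  by move=> /allP /(_ i); rewrite mem_index_enum sqrf_eq0 => /(_ isT) /eqP.
by rewrite /c big1 ?expr0n/= ?mulr_ge0// => i _; rewrite v0 mulr0.
Qed.

(** Written as [1 / (1 + expR (- s))], the probability loses at most a factor [expR (- D)] when the
    score [s] moves by at most [D], and Cauchy-Schwarz bounds the movement of the score. *)
Lemma logit_pmf_lipschitz th a (y : bool) x :
  logit_pmf a y x * expR (- (norm2 x * Num.sqrt (sqdist th a))) <= logit_pmf th y x.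
Proof.
set s := label R y * dotv x th; set s' := label R y * dotv x a.
set D := norm2 x * _.
have pE (u : R) : expR u / (1 + expR u) = (1 + expR (- u))^-1.
  by rewrite expRN; have e0 := expR_gt0 u; field; rewrite !gt_eqF//=; lra.
have ss : `|s - s'| <= D.
  rewrite /s /s' -mulrBr normrM.
  have -> : `|label R y| = 1 by rewrite /label; case: y {s s'}; rewrite ?normrN normr1.
  rewrite mul1r /dotv -sumrB; apply: le_trans (cauchy_schwarz_sum _ _).
  by rewrite le_eqVlt; apply/orP; left; apply/eqP; congr `|_|; apply: eq_bigr => i _; ring.
rewrite /logit_pmf -/s -/s' !pE [expR (- D)]expRN -invfM.
rewrite lef_pV2 ?posrE ?mulr_gt0 ?addr_gt0 ?expR_gt0//.
have D0 : 0 <= D by rewrite mulr_ge0 ?norm2_ge0 ?sqrtr_ge0.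
rewrite mulrDl mul1r lerD//; first by rewrite -expR0 ler_expR.
rewrite -expRD ler_expR.
by move: ss; rewrite ler_norml => /andP[]; lra.
Qed.

End logistic_lipschitz.

Section logistic_evidence.
Context (R : realType) (d n : nat).
Variables (C1 tau alpha : R) (a : vec R d).
Hypotheses (alpha_gt0 : 0 < alpha) (C1_gt0 : 0 < C1) (tau_gt0 : 0 < tau) (n_gt0 : (0 < n)%N).
Hypothesis d_tau : d%:R * tau ^+ 2 = n%:R ^- 2.
Hypothesis aC1 : norm1 a <= C1 - 2 * d%:R * tau.

Definition joint_pmf (th : vec R d) (z : bool * vec R d) : R := logit_pmf th z.1 z.2.

Lemma prior_evidence_lower_bound (z : 'I_n -> bool * vec R d) :
  ((expR (- (\sum_i (2 * alpha / n%:R * norm2 (z i).2) + ln (2 * tail_factor tau a))) *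
   \prod_i (joint_pmf a (z i)) `^ alpha)%:E <=
  evidence (prior d C1 tau) joint_pmf alpha z)%E.
Proof.
have n0 : 0 < n%:R :> R by rewrite ltr0n.
have E0 := tail_factor_gt0 tau_gt0 a.
pose Q := \prod_i (joint_pmf a (z i)) `^ alpha.
have Q0 : 0 < Q by apply: prodr_gt0 => i _; rewrite powR_gt0// logit_pmf_gt0.
pose G th := power_likelihood joint_pmf alpha z th / Q.
have mL : measurable_fun setT (power_likelihood joint_pmf alpha z).
  apply: (measurableT_comp (measurable_powR alpha)).
  by apply: measurable_prod => i _; exact: measurable_logit_pmf_param.
have mG : measurable_fun setT G by exact: measurable_funM.
(* Lipschitz constant of the log of [power_likelihood] in the parameter. The exponent [2 * t / n] of
   the prior bound splits into a cost [2 * alpha / n] times the norm of each design vector. *)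
pose t := alpha * \sum_i norm2 (z i).2.
have t0 : 0 <= t.
  by rewrite mulr_ge0 ?(ltW alpha_gt0)// sumr_ge0// => i _; exact: norm2_ge0.
have HG th : expR (- (t * Num.sqrt (sqdist th a))) <= G th.
  rewrite /G ler_pdivlMr// /Q -powR_prod; last by move=> i; exact/ltW/logit_pmf_gt0.
  have -> : expR (- (t * Num.sqrt (sqdist th a))) =
      (\prod_i expR (- (norm2 (z i).2 * Num.sqrt (sqdist th a)))) `^ alpha.
    rewrite -expR_sum sumrN -mulr_suml /powR gt_eqF ?expR_gt0// expRK.
    by rewrite /t mulrN mulrA.
  rewrite -powRM; last 2 first.
  - by apply: prodr_ge0 => i _; exact: expR_ge0.
  - by apply: prodr_ge0 => i _; exact/ltW/logit_pmf_gt0.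
  rewrite -big_split/= /power_likelihood; apply: ge0_ler_powR.
  - exact: ltW.
  - rewrite nnegrE; apply: prodr_ge0 => i _; rewrite mulr_ge0 ?expR_ge0//.
    exact/ltW/logit_pmf_gt0.
  - by rewrite nnegrE; apply: prodr_ge0 => i _; exact/ltW/logit_pmf_gt0.
  apply: ler_prod => i _; rewrite mulr_ge0 ?expR_ge0//=; last exact/ltW/logit_pmf_gt0.
  by rewrite mulrC; exact: logit_pmf_lipschitz.
have := prior_lower_bound tau_gt0 C1_gt0 n0 d_tau t0 aC1 mG HG.
have -> : (\int[prior d C1 tau]_th (G th)%:E =
    (Q^-1)%:E * evidence (prior d C1 tau) joint_pmf alpha z)%E.
  rewrite -ge0_integralZl//.
  - by apply: eq_integral => th _; rewrite -EFinM mulrC.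
  - exact/measurable_EFinP.
  - by move=> th _; rewrite lee_fin powR_ge0.
  - by rewrite lee_fin invr_ge0 ltW.
rewrite muleC lee_pdivlMr// -EFinM; apply: le_trans.
rewrite lee_fin ler_wpM2r ?(ltW Q0)//.
rewrite opprD expRD [X in _ * X]expRN lnK ?posrE ?mulr_gt0//.
rewrite -mulr_sumr (_ : 2 * t / n%:R = 2 * alpha / n%:R * \sum_i norm2 (z i).2)//.
by rewrite /t; ring.
Qed.

End logistic_evidence.

Section risk_bound_constants.
Context (R : realType) (d n : nat).
Variables (C1 tau : R) (a : vec R d).
Hypotheses (C1_gt0 : 0 < C1) (tau_gt0 : 0 < tau).

Lemma ln_tail_factor_le : norm1 a <= C1 - 2 * d%:R * tau ->
  ln (2 * tail_factor tau a) <=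
  4 * (norm0 a)%:R * ln (C1 / tau / (norm0 a)%:R) + ln 2.
Proof.
move=> aC1; have E0 := tail_factor_gt0 tau_gt0 a.
rewrite lnM ?posrE// addrC lerD2r.
have := tail_factor_le tau_gt0 C1_gt0 aC1.
set s := norm0 a; set C := C1 / tau / s%:R => H.
(* For [s = 0] the logarithm of a quotient by 0 is multiplied by 0, which realises the convention
   that 0 log(c/0) is 0. *)
have [s0|s0] := posnP s.
  by rewrite s0 mulr0 mul0r; apply: ln_le0; move: H; rewrite s0 muln0 expr0.
have C0 : 0 < C by rewrite !divr_gt0// ltr0n.
apply: (@le_trans _ _ (ln (C ^+ (4 * s)))).
  by rewrite ler_ln ?posrE// exprn_gt0.
by rewrite lnXn// -[X in X <= _]mulr_natl natrM.
Qed.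

End risk_bound_constants.

Section design_moments.
Local Open Scope ereal_scope.
Context (R : realType) (d : nat) (P0 : probability (bool * vec R d)%type R).

Lemma integrable_norm2_snd :
  \int[P0]_z (norm2 z.2 ^+ 2)%:E < +oo ->
  P0.-integrable setT (fun z => (norm2 z.2)%:E).
Proof.
move=> fin2.
have mn : measurable_fun setT (fun z : bool * vec R d => norm2 z.2).
  exact: (measurableT_comp (@measurable_norm2 R d) measurable_snd).
apply/integrableP; split; first exact/measurable_EFinP.
apply: (@le_lt_trans _ _ (\int[P0]_z (1 + (norm2 z.2 ^+ 2)%:E))).
  apply: ge0_le_integral => //.
  - by apply: measurableT_comp => //; exact/measurable_EFinP.
  - by apply: emeasurable_funD => //; apply/measurable_EFinP; exact: measurable_funX.
  move=> z _; have h : (norm2 z.2 <= 1 + norm2 z.2 ^+ 2)%R.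
    by have := sqr_ge0 (norm2 z.2 - 1); have := sqr_ge0 (norm2 z.2); lra.
  rewrite gee0_abs; last by rewrite lee_fin norm2_ge0.
  by move: h; rewrite -lee_fin EFinD.
rewrite ge0_integralD//; last 2 first.
- by move=> z _; rewrite lee_fin sqr_ge0.
- by apply/measurable_EFinP; exact: measurable_funX.
rewrite lte_add_pinfty// integral_cst// mul1e.
exact: (le_lt_trans (probability_le1 P0 measurableT) (ltry 1)).
Qed.

End design_moments.

Section logistic_renyi.
Local Open Scope ereal_scope.
Context (R : realType) (d : nat) (m : probability (vec R d) R).

Lemma logit_ratio_integral (th a : vec R d) :
  \int[logit_model m a]_z (joint_pmf th z / joint_pmf a z)%:E = 1.
Proof.
have := logit_model_density m th a measurableT.
by rewrite [X in X = _](probability_setT (logit_model m th)) => ->.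
Qed.

Lemma measurable_joint_pmf (a : vec R d) : measurable_fun setT (joint_pmf a).
Proof. by apply: (measurable_logit_pmf_joint (th := cst a) (z := id)). Qed.

(** Passing from the affinity to its power [- n] replaces a nonpositive logarithm by a nonnegative
    one and produces the quantity bounded under the posterior, so that only the scalar
    [1 / (n (1 - alpha))] remains. *)
Lemma renyi_div_logit_model (alpha : R) (P0 : probability (bool * vec R d)%type R)
    (q : bool * vec R d -> R) (a th : vec R d) (n : nat) :
  (0 < alpha)%R -> (alpha < 1)%R -> (0 < n)%N ->
  measurable_fun setT q -> (forall z, 0 <= q z)%R ->
  (forall A, measurable A -> P0 A = \int[logit_model m a]_(z in A) (q z)%:E) ->
  renyi_div alpha (logit_model m th) P0 =
  ((n%:R * (1 - alpha))^-1 *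
   ln (inverse_affinity_power (logit_model m a) (@joint_pmf R d) (joint_pmf a) q alpha n th))%:E.
Proof.
move=> alpha_gt0 alpha_lt1 n_gt0 mq q0 P0E.
have mj : measurable_fun setT (fun u : vec R d * (bool * vec R d) => joint_pmf u.1 u.2).
  exact: (measurable_logit_pmf_joint measurable_fst measurable_snd).
have p_gt0 (t : vec R d) z : (0 < joint_pmf t z)%R by exact: logit_pmf_gt0.
rewrite (@renyi_div_density _ _ _ alpha (logit_model m th) P0 (logit_model m a)
  (logit_ratio th a) q)//; last 3 first.
- exact: (measurable_logit_ratio (th := cst th) (th' := cst a) (z := id)).
- by move=> z; exact: logit_ratio_gt0.
- by move=> A mA; exact: logit_model_density.
have affE := model_affinityE alpha_gt0 alpha_lt1 mj p_gt0 (measurable_joint_pmf a)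
  (p_gt0 a) mq q0 P0E (logit_ratio_integral ^~ a) th.
have /andP[aff0 _] := model_affinity_bounds alpha_gt0 alpha_lt1 mj p_gt0
  (measurable_joint_pmf a) (p_gt0 a) mq q0 P0E (logit_ratio_integral ^~ a) th.
rewrite -[X in lne X]/(affinity alpha (logit_model m a) _ q) -affE lne_EFin// -EFinM; congr EFin.
set x := model_affinity _ _ _ _ _ _ in aff0 *.
have -> : ln (inverse_affinity_power (logit_model m a) (@joint_pmf R d) (joint_pmf a) q
    alpha n th) = (- (n%:R * ln x))%R.
  by rewrite /inverse_affinity_power -/x lnV ?posrE ?exprn_gt0// lnXn// mulr_natl.
rewrite mulrN mulrA -mulNr; congr (_ * _)%R.
have n0 : (n%:R != 0 :> R)%R by rewrite pnatr_eq0 -lt0n.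
by rewrite invfM mulrAC mulVf// mul1r -invrN opprB.
Qed.

End logistic_renyi.

Theorem theorem3p4 (R : realType) (d n : nat) (d_gt0 : (0 < d)%N) (n_gt0 : (0 < n)%N)
    (P0 : probability (bool * vec R d)%type R)
    (disp : measure_display) (Omega : measurableType disp)
    (P : probability Omega R)
    (Z : 'I_n -> {mfun Omega >-> (bool * vec R d)%type})
    (Z_indep : mutually_independent P Z)
    (Z_law : forall i : 'I_n, has_law P (Z i) P0)
    (Theta : set (vec R d)) (C1 tau alpha : R) (theta_star : vec R d)
    (misspecified : forall theta : vec R d, Theta theta ->
       ~ (forall A : set (bool * vec R d), measurable A ->
            logit_model (x_marginal P0) theta A = P0 A))
    (theta_star_in : Theta theta_star)
    (theta_star_argmin : forall theta : vec R d, Theta theta ->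
       (kl_div P0 (logit_model (x_marginal P0) theta_star)
        <= kl_div P0 (logit_model (x_marginal P0) theta))%E)
    (X1_sq_int : ('E_P[(fun w => norm2 (Z (Ordinal n_gt0) w).2 ^+ 2)%R] < +oo)%E)
    (C1_gt0 : 0 < C1)
    (prior_supp : l1_ball C1 `<=` Theta)
    (tau_def : tau = (n%:R * Num.sqrt d%:R)^-1)
    (C1_tau : 2 * d%:R * tau < C1)
    (theta_star_norm1 : norm1 theta_star <= C1 - 2 * d%:R * tau)
    (alpha_gt0 : 0 < alpha) (alpha_lt1 : alpha < 1) :
  let K1 : R := 2 * fine ('E_P[(fun w => norm2 (Z (Ordinal n_gt0) w).2)%R])%E in
  let s : R := (norm0 theta_star)%:R in
  let r_n : R :=
    Num.max (K1 / n%:R)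
      ((4 * s * ln (C1 * n%:R * Num.sqrt d%:R / s) + ln 2) / n%:R) in
  (\int[P]_w
     \int[frac_posterior (prior d C1 tau) alpha (fun i => Z i w)]_theta
       renyi_div alpha (logit_model (x_marginal P0) theta) P0
   <= (alpha / (1 - alpha))%:E *
        ereal_inf [set kl_div P0 (logit_model (x_marginal P0) theta) | theta in Theta]
      + ((1 + alpha) / (1 - alpha) * r_n)%:E)%E.
Proof.
cbv zeta.
set K1 : R := 2 * fine _; set s : R := (norm0 theta_star)%:R.
set r_n : R := Num.max _ _.
set m := x_marginal P0; set M := logit_model m theta_star.
have n0 : 0 < n%:R :> R by rewrite ltr0n.
have d0 : 0 < d%:R :> R by rewrite ltr0n.
have alpha1 : 0 < 1 - alpha by rewrite subr_gt0.
have tau_gt0 : 0 < tau by rewrite tau_def invr_gt0 mulr_gt0// sqrtr_gt0.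
have d_tau : d%:R * tau ^+ 2 = n%:R ^- 2.
  rewrite tau_def exprVn exprMn sqr_sqrtr ?ltW// invfM mulrCA divff ?mulr1//.
  by rewrite gt_eqF.
have infE : ereal_inf [set kl_div P0 (logit_model m theta) | theta in Theta] =
    kl_div P0 M.
  apply/eqP; rewrite eq_le; apply/andP; split.
    by apply: ereal_inf_lbound; exists theta_star.
  by apply: le_ereal_inf_tmp => _ [theta Ttheta <-]; exact: theta_star_argmin.
rewrite infE.
have [klE|kl_ltoo] := eqVneq (kl_div P0 M) +oo%E.
  by rewrite klE gt0_muley ?lte_fin ?divr_gt0// addye// leey.
have P0M : P0 `<< M.
  by apply: contrapT => nP0M; move: kl_ltoo; rewrite /kl_div asboolF// eqxx.
have [q [mq q0 P0E klE]] := kl_div_density P0M.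
have iq : P0.-integrable setT (EFin \o (fun z => ln (q z))).
  by apply: (integrable_ln_density mq q0 P0E); rewrite -klE ltey.
have mj : measurable_fun setT (fun u : vec R d * (bool * vec R d) => joint_pmf u.1 u.2).
  exact: (measurable_logit_pmf_joint measurable_fst measurable_snd).
have p_gt0 (t : vec R d) z : 0 < joint_pmf t z by exact: logit_pmf_gt0.
have p_le1 (t : vec R d) z : joint_pmf t z <= 1 by exact: logit_pmf_le1.
have mps := measurable_joint_pmf theta_star.
have rint th := logit_ratio_integral m th theta_star.
pose i0 := Ordinal n_gt0.
have mn : measurable_fun setT (fun z : bool * vec R d => norm2 z.2).
  exact: (measurableT_comp (@measurable_norm2 R d) measurable_snd).
have inorm : P0.-integrable setT (fun z => (norm2 z.2)%:E).
  apply: integrable_norm2_snd.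
  rewrite -(ge0_integral_law Z_law i0 (f := fun z => (norm2 z.2 ^+ 2)%:E)).
  - by move: X1_sq_int; rewrite unlock.
  - by apply/measurable_EFinP; exact: measurable_funX.
  - by move=> z; rewrite lee_fin sqr_ge0.
have K1E : (\int[P0]_z (norm2 z.2)%:E)%E = (K1 / 2)%:E.
  rewrite /K1 unlock (ge0_integral_law Z_law i0 (f := fun z => (norm2 z.2)%:E)).
  - by rewrite mulrAC divff ?mul1r ?fineK//; exact: integrable_fin_num.
  - exact/measurable_EFinP.
  - by move=> z; rewrite lee_fin norm2_ge0.
(* Cost of one observation in the evidence bound; its mean is [alpha * K1 / n] because [K1] is twice
   the mean norm. *)
pose b (z : bool * vec R d) : R := 2 * alpha / n%:R * norm2 z.2.
have ib : P0.-integrable setT (EFin \o b).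
  by rewrite (_ : EFin \o b = fun z => (2 * alpha / n%:R)%:E * (norm2 z.2)%:E)%E//;
    exact: integrableZl.
have bE : fine (\int[P0]_z (b z)%:E)%E = alpha * (K1 / n%:R).
  rewrite /b; under eq_integral do rewrite EFinM.
  rewrite integralZl// K1E -EFinM/=; field.
  by rewrite gt_eqF.
pose kappa := ln (2 * tail_factor tau theta_star).
have bev z := prior_evidence_lower_bound alpha_gt0 C1_gt0 tau_gt0 n_gt0 d_tau
  theta_star_norm1 z.
have bound := expectation_posterior_ln_le alpha_gt0 alpha_lt1 mj p_gt0 p_le1 mps
  (p_gt0 theta_star) mq q0 P0E rint Z_indep Z_law iq ib bev.
rewrite bE in bound.
set y := inverse_affinity_power _ _ _ _ _ _ in bound.
have y1 th : 1 <= y th.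
  exact: (inverse_affinity_power_ge1 n alpha_gt0 alpha_lt1 mj p_gt0 mps
    (p_gt0 theta_star) mq q0 P0E rint).
have my : measurable_fun setT (fun th => ln (y th)).
  apply: (measurableT_comp (@measurable_ln R)).
  exact: (measurable_inverse_affinity_power n alpha_gt0 alpha_lt1 mj p_gt0 mps
    (p_gt0 theta_star) mq q0 P0E rint).
have ly0 th : 0 <= ln (y th) by rewrite ln_ge0.
pose k := (n%:R * (1 - alpha))^-1.
have k0 : 0 <= k by rewrite invr_ge0 mulr_ge0 ?ltW.
have inner w : (\int[frac_posterior (prior d C1 tau) alpha (fun i => Z i w)]_theta
     renyi_div alpha (logit_model m theta) P0 =
   k%:E * \int[posterior (prior d C1 tau) alpha mj p_gt0 (fun i => Z i w)]_theta
     (ln (y theta))%:E)%E.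
  rewrite -ge0_integralZl//; last 2 first.
  - exact/measurable_EFinP.
  - by move=> th _; rewrite lee_fin.
  (* [frac_posterior] and [posterior] differ only in the proofs of measurability and nonnegativity
     that they carry, so they agree on every set. *)
  transitivity (\int[frac_posterior (prior d C1 tau) alpha (fun i => Z i w)]_theta
      (k%:E * (ln (y theta))%:E))%E; last exact: eq_measure_integral.
  apply: eq_integral => th _; rewrite -EFinM.
  exact: (renyi_div_logit_model th alpha_gt0 alpha_lt1 n_gt0 mq q0 P0E).
under eq_integral do rewrite inner.
rewrite ge0_integralZl//; last 2 first.
- exact: measurable_integral_posterior.
- by move=> w _; apply: integral_ge0 => th _; rewrite lee_fin.
apply: (le_trans (lee_wpmul2l _ bound)); first by rewrite lee_fin.
rewrite klE; have Kfin := integrable_fin_num measurableT iq.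
rewrite -[in leRHS](fineK Kfin); set K := fine _.
rewrite -!EFinM -EFinD lee_fin.
(* The remainder is [alpha * K1 / n + kappa / n], and each of [K1 / n] and [kappa / n] lies below
   one argument of the maximum [r_n]; hence the coefficient [1 + alpha]. *)
have K1r : K1 / n%:R <= r_n by rewrite /r_n le_max lexx.
have kr : kappa / n%:R <= r_n.
  rewrite /r_n le_max; apply/orP; right; rewrite ler_pM2r ?invr_gt0//.
  apply: (le_trans (ln_tail_factor_le C1_gt0 tau_gt0 theta_star_norm1)).
  by rewrite tau_def invrK mulrA.
rewrite -/kappa.
have -> : k * (n%:R * (alpha * K + alpha * (K1 / n%:R)) + kappa) =
    alpha / (1 - alpha) * K + (1 - alpha)^-1 * (alpha * (K1 / n%:R) + kappa / n%:R).
  by rewrite /k; field; rewrite !gt_eqF.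
rewrite lerD2l -[leRHS]mulrA [leRHS]mulrCA ler_pM2l ?invr_gt0//.
by have := ler_wpM2l (ltW alpha_gt0) K1r; lra.
Qed.
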